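(* There is a computable function $\kappa : \mathbb{N} \to \mathbb{N}$ such that for every $n \in \mathbb{N}$ the following multivalued map $\operatorname{Zero}_{n \min} :\subseteq \mathcal{C}([0,1],\mathbb{R}) \rightrightarrows [0,1]^{\kappa(n)}$ is computable: its domain consists of those continuous $f : [0,1]\to\mathbb{R}$ which have at most $n$ local minima and satisfy $f(0)\neq 0 \neq f(1)$, and $(x_1,\ldots,x_{\kappa(n)}) \in \operatorname{Zero}_{n\min}(f)$ iff for every $x \in [0,1]$ with $f(x) = 0$ there is some $i$ with $x_i = x$.
   Context: $\mathcal{C}([0,1],\mathbb{R})$ is the space of continuous real functions on $[0,1]$ with its standard representation (as in computable analysis); $[0,1]^k$ carries the standard Cauchy representation. A multivalued map is computable if some computable function on names maps every name of an input to a name of some admissible output. Local extrema are understood so as to exclude plateaux. *)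

(* Defs.v *)
From Stdlib Require Import Reals Lra Lia ZArith Arith List.
Open Scope R_scope.

Inductive prog : Type :=
| PZero : prog
| PSucc : prog
| PProj : nat -> prog
| PComp : prog -> list prog -> prog
| PRec  : prog -> prog -> prog
| PMin  : prog -> prog.

Inductive eval : prog -> list nat -> nat -> Prop :=
| eZero v : eval PZero v 0
| eSucc v : eval PSucc v (S (hd 0%nat v))
| eProj i v : eval (PProj i) v (nth i v 0%nat)
| eComp f gs v ws y : evals gs v ws -> eval f ws y -> eval (PComp f gs) v y
| eRec0 f g v y : eval f v y -> eval (PRec f g) (0%nat :: v) y
| eRecS f g n v r y :
    eval (PRec f g) (n :: v) r -> eval g (n :: r :: v) y ->
    eval (PRec f g) (S n :: v) y
| eMin f v n :
    eval f (n :: v) 0%nat ->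
    (forall m, (m < n)%nat -> exists k, eval f (m :: v) (S k)) ->
    eval (PMin f) v n
with evals : list prog -> list nat -> list nat -> Prop :=
| esNil v : evals nil v nil
| esCons g gs v w ws : eval g v w -> evals gs v ws -> evals (g :: gs) v (w :: ws).

Definition computable_fun (f : nat -> nat) : Prop :=
  exists P : prog, forall n, eval P (n :: nil) (f n).

(* pair a b = 2^a * (2b+1) - 1, a bijection nat*nat -> nat *)
Definition npair (a b : nat) : nat := (2 ^ a * (2 * b + 1) - 1)%nat.

Fixpoint val2 (fuel n : nat) : nat * nat :=
  match fuel with
  | O => (0%nat, n)
  | S f => if andb (Nat.even n) (Nat.ltb 0 n) then
             let (a, o) := val2 f (Nat.div2 n) in (S a, o)
           else (0%nat, n)
  end.

Definition nunpair (m : nat) : nat * nat :=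
  let (a, o) := val2 (S m) (S m) in (a, Nat.div2 o).

Fixpoint code_list (l : list nat) : nat :=
  match l with
  | nil => 0%nat
  | a :: l' => S (npair a (code_list l'))
  end.

Fixpoint decl (fuel m : nat) : list nat :=
  match fuel, m with
  | S f, S m' => let (a, b) := nunpair m' in a :: decl f b
  | _, _ => nil
  end.

Definition decode_list (m : nat) : list nat := decl m m.

(** * Type-2 computability via associates (Kleene/Weihrauch) *)

Definition Baire := nat -> nat.

Definition prefix (p : Baire) (k : nat) : list nat := map p (seq 0 k).

(* [assoc_app alpha p n m]: the functional with associate alpha, applied
   to p, outputs m at position n. *)
Definition assoc_app (alpha : Baire) (p : Baire) (n m : nat) : Prop :=
  exists k, alpha (code_list (n :: prefix p k)) = S m /\
    forall j, (j < k)%nat -> alpha (code_list (n :: prefix p j)) = 0%nat.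

Definition mv_computable {X Y : Type}
  (nameX : Baire -> X -> Prop) (nameY : Baire -> Y -> Prop)
  (dom : X -> Prop) (F : X -> Y -> Prop) : Prop :=
  exists alpha : Baire, computable_fun alpha /\
    forall x, dom x -> forall p, nameX p x ->
      exists q : Baire, (forall n, assoc_app alpha p n (q n)) /\
        exists y, nameY q y /\ F x y.

Definition zdec (a : nat) : Z :=
  if Nat.even a then Z.of_nat (Nat.div2 a) else (- Z.of_nat (Nat.div2 (S a)))%Z.

(* surjective decoding nat -> Q, viewed in R *)
Definition ratR (m : nat) : R :=
  let (a, b) := nunpair m in IZR (zdec a) / INR (S b).

Definition name_R (p : Baire) (x : R) : Prop :=
  forall n, Rabs (ratR (p n) - x) <= / 2 ^ n.

(* Cauchy representation of [0,1]^k (tupling of names); a point of [0,1]^k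
   is given by its coordinates y 0, ..., y (k-1). *)
Definition name_cube (k : nat) (q : Baire) (y : nat -> R) : Prop :=
  forall i, (i < k)%nat ->
    0 <= y i <= 1 /\ name_R (fun n => q (npair i n)) (y i).

(* rational polynomial coded by a list of coefficient codes (constant first) *)
Definition poly_eval (l : list nat) (x : R) : R :=
  fold_right (fun c acc => ratR c + x * acc) 0 l.

Definition cont01 (f : R -> R) : Prop :=
  forall x, 0 <= x <= 1 -> forall eps, 0 < eps -> exists delta, 0 < delta /\
    forall y, 0 <= y <= 1 -> Rabs (y - x) < delta -> Rabs (f y - f x) < eps.

(* standard representation of C([0,1],R): fast converging sequences of
   rational polynomials in the supremum norm (only values on [0,1] matter) *)
Definition name_C (p : Baire) (f : R -> R) : Prop :=
  forall n x, 0 <= x <= 1 ->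
    Rabs (f x - poly_eval (decode_list (p n)) x) <= / 2 ^ n.

(** * Local minima (plateaux are not excluded by fiat: every point of a
    plateau is a local minimum, so functions with plateaux have infinitely
    many local minima) *)
Definition local_min (f : R -> R) (x : R) : Prop :=
  0 <= x <= 1 /\ exists d, 0 < d /\
    forall y, 0 <= y <= 1 -> Rabs (y - x) < d -> f x <= f y.

Definition at_most_n_local_minima (n : nat) (f : R -> R) : Prop :=
  exists l : list R, (length l <= n)%nat /\ forall x, local_min f x -> In x l.

Definition Zero_dom (n : nat) (f : R -> R) : Prop :=
  cont01 f /\ at_most_n_local_minima n f /\ f 0 <> 0 /\ f 1 <> 0.

Definition Zero_rel (k : nat) (f : R -> R) (y : nat -> R) : Prop :=
  forall x, 0 <= x <= 1 -> f x = 0 -> exists i, (i < k)%nat /\ y i = x.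

(* Main.v *)
(* [|f|] has only finitely many zeros on [0,1], and at any moment an interval [a,b] with
   [f a, f b <> 0] can effectively either be shrunk around its zeros, or be split at a point
   [x] such that [|f|] dips (is smaller at some inner point than at both ends) on [a,x] and on
   [x,b]: if there are two zeros in [a,b], any [x] between them with [f x <> 0] will do, and
   otherwise the complement of a small interval is effectively seen to be free of zeros.
   Three disjoint dips enclose a local minimum of [f], so there are at most [3 n + 2]
   disjoint dips and hence no branch of the search meets more than [3 n + 1] splits. The
   point with index [i < 2 ^ (3 n + 1)] follows the branch given by the binary digits of [i];
   all branches together contain all zeros. *)
Require Import Defs.
From Stdlib Require Import Reals Lra Lia ZArith Arith List IndefiniteDescription.
Import ListNotations.
Open Scope R_scope.

(** * Computable functions of several variables *)

Local Open Scope nat_scope.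

(** Whether an interval contains no, one or several zeros cannot be decided from a name, and
    [f x = 0] can never be confirmed. So neither kind of step claims that a zero exists: both are
    finite systems of rational comparisons, confirmable from a finite prefix, and the distinction by
    the number of zeros only shows that some certificate exists. Several may be available at once;
    taking the least one makes the search a function of the name, the time and the interval. It
    ignores the unread digits, so all branches live in one binary tree. Branches without zeros
    converge too, which is harmless because the listed points need not be zeros. A split need not
    make the interval small; only a shrinking at time [t] forces the width below [/ 2 ^ t]. The
    bound on splits is therefore what makes the branches converge: a split leaves one dip on the
    other side, so each half has room for one dip fewer, and among any [3 n + 2] consecutive steps
    at least one shrinks. *)

Definition computed {X : Type} (gs : list (X -> nat)) (f : X -> nat) : Prop :=
  exists P, forall x, eval P (map (fun g => g x) gs) (f x).

Lemma computed_ext {X} (gs : list (X -> nat)) f g :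
  (forall x, f x = g x) -> computed gs f -> computed gs g.
Proof. intros E [P HP]. exists P. intros x. rewrite <- E. apply HP. Qed.

(** The list [gs] acts as a context of variables over the environment type [X], and [i] is a de
    Bruijn index into it. *)
Lemma computed_proj {X} (gs : list (X -> nat)) f i :
  (forall x, nth i (map (fun g => g x) gs) 0 = f x) -> computed gs f.
Proof. intros E. exists (PProj i). intros x. rewrite <- E. constructor. Qed.

Lemma computed_subst {X Y} (gs : list (X -> nat)) (hs : list (Y -> nat)) g (phi : X -> Y) :
  computed hs g -> Forall (fun h => computed gs (fun x => h (phi x))) hs ->
  computed gs (fun x => g (phi x)).
Proof.
  intros [P HP] Hs.
  assert (exists Qs, forall x,
    evals Qs (map (fun g => g x) gs) (map (fun h => h (phi x)) hs)) as [Qs HQs].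
  { clear HP. induction Hs as [|h hs [Q HQ] _ [Qs HQs]].
    - exists nil. constructor.
    - exists (Q :: Qs). constructor; auto. }
  exists (PComp P Qs). intros x. econstructor; eauto.
Qed.

Lemma computed_comp1 {X} (gs : list (X -> nat)) (g : nat -> nat) a :
  computed [fun n : nat => n] g -> computed gs a -> computed gs (fun x => g (a x)).
Proof. intros Hg Ha. apply (computed_subst gs _ g a Hg). auto. Qed.

Lemma computed_comp2 {X} (gs : list (X -> nat)) (g : nat -> nat -> nat) a b :
  computed [@fst nat nat; @snd nat nat] (fun y => g (fst y) (snd y)) ->
  computed gs a -> computed gs b -> computed gs (fun x => g (a x) (b x)).
Proof.
  intros Hg Ha Hb.
  apply (computed_subst gs _ (fun y => g (fst y) (snd y)) (fun x => (a x, b x)) Hg).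
  auto.
Qed.

Lemma computed_succ {X} (gs : list (X -> nat)) a :
  computed gs a -> computed gs (fun x => S (a x)).
Proof.
  apply computed_comp1. exists PSucc. intros n. apply (eSucc [n]).
Qed.

Lemma computed_const {X} (gs : list (X -> nat)) c : computed gs (fun _ => c).
Proof.
  induction c as [|c IH].
  - exists PZero. constructor.
  - apply computed_succ, IH.
Qed.

Definition primrec (b : nat) (h : nat -> nat -> nat) (n : nat) : nat :=
  nat_rect (fun _ => nat) b h n.

(** Weakening of the context under a binder whose bound values are stored in [Y]. *)
Definition lift {X Y} (gs : list (X -> nat)) : list (X * Y -> nat) :=
  map (fun g y => g (fst y)) gs.

Lemma computed_primrec {X} (gs : list (X -> nat)) b h n :
  computed gs b ->
  computed ((fun y : X * (nat * nat) => fst (snd y)) :: (fun y => snd (snd y)) :: lift gs)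
    (fun y => h (fst y) (fst (snd y)) (snd (snd y))) ->
  computed gs n ->
  computed gs (fun x => primrec (b x) (fun i r => h x i r) (n x)).
Proof.
  intros [B HB] [H HH] Hn.
  apply (computed_subst gs (snd :: lift gs)
    (fun y : X * nat => primrec (b (fst y)) (fun i r => h (fst y) i r) (snd y))
    (fun x => (x, n x))).
  - exists (PRec B H). intros [x m]. unfold lift. simpl. rewrite map_map.
    induction m as [|m IH].
    + apply eRec0, HB.
    + eapply eRecS; [exact IH|].
      specialize (HH (x, (m, primrec (b x) (fun i r => h x i r) m))).
      unfold lift in HH. simpl in HH. rewrite map_map in HH. exact HH.
  - constructor; [exact Hn|].
    apply Forall_forall. intros g Hg. unfold lift in Hg.
    apply in_map_iff in Hg. destruct Hg as (g0 & <- & Hg0).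
    destruct (In_nth gs g0 (fun _ => 0) Hg0) as (i & Hi & Ei).
    apply computed_proj with (i := i). intros x. rewrite <- Ei.
    exact (map_nth (fun g : X -> nat => g x) gs (fun _ => 0) i).
Qed.

Create HintDb computed.
Hint Constants Opaque : computed.

Ltac computed_var :=
  match goal with |- computed _ _ => idtac end;
  first
  [ apply computed_proj with (i := 0); intro; reflexivity
  | apply computed_proj with (i := 1); intro; reflexivity
  | apply computed_proj with (i := 2); intro; reflexivity
  | apply computed_proj with (i := 3); intro; reflexivity
  | apply computed_proj with (i := 4); intro; reflexivity
  | apply computed_proj with (i := 5); intro; reflexivity
  | apply computed_proj with (i := 6); intro; reflexivity
  | apply computed_proj with (i := 7); intro; reflexivity
  | apply computed_proj with (i := 8); intro; reflexivity ].

Ltac computed_tac := auto 100 with computed nocore.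

Hint Resolve computed_const : computed.
Hint Resolve computed_succ computed_primrec : computed.
Hint Extern 20 (computed _ _) => computed_var : computed.

Lemma computed_add {X} (gs : list (X -> nat)) a b :
  computed gs a -> computed gs b -> computed gs (fun x => a x + b x).
Proof.
  apply computed_comp2.
  apply computed_ext with (fun y => primrec (fst y) (fun _ r => S r) (snd y)).
  - intros [m n]. simpl. induction n; simpl in *; lia.
  - computed_tac.
Qed.
Hint Resolve computed_add : computed.

Lemma computed_mul {X} (gs : list (X -> nat)) a b :
  computed gs a -> computed gs b -> computed gs (fun x => a x * b x).
Proof.
  apply computed_comp2.
  apply computed_ext with (fun y => primrec 0 (fun _ r => r + fst y) (snd y)).
  - intros [m n]. simpl. induction n; simpl in *; lia.
  - computed_tac.
Qed.
Hint Resolve computed_mul : computed.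

Lemma computed_pow {X} (gs : list (X -> nat)) a b :
  computed gs a -> computed gs b -> computed gs (fun x => a x ^ b x).
Proof.
  apply computed_comp2.
  apply computed_ext with (fun y => primrec 1 (fun _ r => r * fst y) (snd y)).
  - intros [m n]. simpl. induction n; simpl in *; lia.
  - computed_tac.
Qed.
Hint Resolve computed_pow : computed.

Lemma computed_pred {X} (gs : list (X -> nat)) a :
  computed gs a -> computed gs (fun x => pred (a x)).
Proof.
  apply computed_comp1.
  apply computed_ext with (fun n => primrec 0 (fun i _ => i) n).
  - intros [|n]; reflexivity.
  - computed_tac.
Qed.
Hint Resolve computed_pred : computed.

Lemma computed_sub {X} (gs : list (X -> nat)) a b :
  computed gs a -> computed gs b -> computed gs (fun x => a x - b x).
Proof.
  apply computed_comp2.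
  apply computed_ext with (fun y => primrec (fst y) (fun _ r => pred r) (snd y)).
  - intros [m n]. simpl. induction n; simpl in *; lia.
  - computed_tac.
Qed.
Hint Resolve computed_sub : computed.

(** Truth values are computed as 0 and 1, so a conditional is a weighted sum. Evaluating both
    branches is safe because both are total. *)
Lemma computed_if {X} (gs : list (X -> nat)) (b : X -> bool) c d :
  computed gs (fun x => Nat.b2n (b x)) -> computed gs c -> computed gs d ->
  computed gs (fun x => if b x then c x else d x).
Proof.
  intros [B HB] [C HC] [D HD].
  apply computed_ext with
    (fun x => Nat.b2n (b x) * c x + (1 - Nat.b2n (b x)) * d x).
  - intros x. destruct (b x); simpl; lia.
  - assert (computed gs (fun x => Nat.b2n (b x))) by now exists B.
    assert (computed gs c) by now exists C.
    assert (computed gs d) by now exists D.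
    computed_tac.
Qed.
Hint Resolve computed_if : computed.

Lemma computed_andb {X} (gs : list (X -> nat)) (b c : X -> bool) :
  computed gs (fun x => Nat.b2n (b x)) -> computed gs (fun x => Nat.b2n (c x)) ->
  computed gs (fun x => Nat.b2n (b x && c x)).
Proof.
  intros Hb Hc. apply computed_ext with (fun x => Nat.b2n (b x) * Nat.b2n (c x)).
  - intros x. now destruct (b x), (c x).
  - computed_tac.
Qed.

Lemma computed_negb {X} (gs : list (X -> nat)) (b : X -> bool) :
  computed gs (fun x => Nat.b2n (b x)) -> computed gs (fun x => Nat.b2n (negb (b x))).
Proof.
  intros Hb. apply computed_ext with (fun x => 1 - Nat.b2n (b x)).
  - intros x. now destruct (b x).
  - computed_tac.
Qed.
Hint Resolve computed_andb computed_negb : computed.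

Lemma computed_orb {X} (gs : list (X -> nat)) (b c : X -> bool) :
  computed gs (fun x => Nat.b2n (b x)) -> computed gs (fun x => Nat.b2n (c x)) ->
  computed gs (fun x => Nat.b2n (b x || c x)).
Proof.
  intros Hb Hc.
  apply computed_ext with (fun x => Nat.b2n (negb (negb (b x) && negb (c x)))).
  - intros x. now destruct (b x), (c x).
  - computed_tac.
Qed.

Lemma computed_leb {X} (gs : list (X -> nat)) a b :
  computed gs a -> computed gs b -> computed gs (fun x => Nat.b2n (a x <=? b x)).
Proof.
  intros Ha Hb. apply computed_ext with (fun x => 1 - (a x - b x)).
  - intros x. destruct (Nat.leb_spec (a x) (b x)); cbn [Nat.b2n]; lia.
  - computed_tac.
Qed.
Hint Resolve computed_orb computed_leb : computed.

Lemma computed_ltb {X} (gs : list (X -> nat)) a b :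
  computed gs a -> computed gs b -> computed gs (fun x => Nat.b2n (a x <? b x)).
Proof. intros Ha Hb. apply (computed_leb gs (fun x => S (a x))); computed_tac. Qed.

Lemma computed_eqb {X} (gs : list (X -> nat)) a b :
  computed gs a -> computed gs b -> computed gs (fun x => Nat.b2n (a x =? b x)).
Proof.
  intros Ha Hb.
  apply computed_ext with (fun x => Nat.b2n ((a x <=? b x) && (b x <=? a x))).
  - intros x. destruct (Nat.leb_spec (a x) (b x)), (Nat.leb_spec (b x) (a x)),
      (Nat.eqb_spec (a x) (b x)); reflexivity || lia.
  - computed_tac.
Qed.
Hint Resolve computed_ltb computed_eqb : computed.

Lemma computed_even {X} (gs : list (X -> nat)) a :
  computed gs a -> computed gs (fun x => Nat.b2n (Nat.even (a x))).
Proof.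
  apply (computed_comp1 gs (fun n => Nat.b2n (Nat.even n))).
  apply computed_ext with (fun n => primrec 1 (fun _ r => 1 - r) n).
  - induction x as [|n IH]; [reflexivity|].
    change (1 - primrec 1 (fun _ r => 1 - r) n = Nat.b2n (Nat.even (S n))).
    rewrite IH, Nat.even_succ, <- Nat.negb_even. now destruct (Nat.even n).
  - computed_tac.
Qed.

Lemma computed_div2 {X} (gs : list (X -> nat)) a :
  computed gs a -> computed gs (fun x => Nat.div2 (a x)).
Proof.
  apply computed_comp1.
  (* The rounded halves of [n] and [S n] add up to [n]. *)
  apply computed_ext with (fun n => primrec 0 (fun i r => i - r) n).
  - induction x as [|n IH]; [reflexivity|].
    change (n - primrec 0 (fun i r => i - r) n = Nat.div2 (S n)).
    rewrite IH.
    pose proof (Nat.div2_odd n) as E1. pose proof (Nat.div2_odd (S n)) as E2.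
    rewrite Nat.odd_succ, <- Nat.negb_odd in E2.
    destruct (Nat.odd n); simpl Nat.b2n in *; lia.
  - computed_tac.
Qed.
Hint Resolve computed_even computed_div2 : computed.

(* The least [c < n] with [P c], and [n] if there is none. *)
Definition search (P : nat -> bool) (n : nat) : nat :=
  primrec 0 (fun _ r => if P r then r else S r) n.

Lemma search_spec P n :
  search P n <= n /\ (search P n < n -> P (search P n) = true) /\
  forall m, m < search P n -> P m = false.
Proof.
  induction n as [|n (L & H & M)].
  - cbn. repeat split; lia.
  - change (search P (S n)) with (if P (search P n) then search P n else S (search P n)).
    destruct (P (search P n)) eqn:E.
    + repeat split; auto.
    + split; [lia|]. split.
      * intros Hlt. discriminate H. lia.
      * intros m Hm. destruct (Nat.eq_dec m (search P n)) as [->|]; [exact E|].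
        apply M. lia.
Qed.

Lemma search_least P n c :
  c < n -> P c = true -> (forall m, m < c -> P m = false) -> search P n = c.
Proof.
  intros Hc HP HM. destruct (search_spec P n) as (L & H & M).
  destruct (Nat.lt_trichotomy (search P n) c) as [Hlt|[E|Hlt]]; [|exact E|].
  - specialize (HM _ Hlt). rewrite H in HM by lia. discriminate.
  - rewrite M in HP by exact Hlt. discriminate.
Qed.

Lemma computed_search {X} (gs : list (X -> nat)) (P : X -> nat -> bool) n :
  computed (snd :: lift gs) (fun y : X * nat => Nat.b2n (P (fst y) (snd y))) ->
  computed gs n -> computed gs (fun x => search (fun c => P x c) (n x)).
Proof.
  intros HP Hn. unfold search.
  apply (computed_primrec gs (fun _ => 0) (fun x _ r => if P x r then r else S r) n);
    [computed_tac| |exact Hn].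
  assert (computed ((fun y : X * (nat * nat) => fst (snd y)) :: (fun y => snd (snd y)) :: lift gs)
    (fun y => Nat.b2n (P (fst y) (snd (snd y))))); [|computed_tac].
  apply (computed_subst _ _ (fun y => Nat.b2n (P (fst y) (snd y)))
    (fun y : X * (nat * nat) => (fst y, snd (snd y))) HP).
  constructor; [computed_tac|].
  apply Forall_forall. intros g Hg. unfold lift in Hg.
  apply in_map_iff in Hg. destruct Hg as (g0 & <- & Hg0).
  destruct (In_nth gs g0 (fun _ => 0) Hg0) as (i & Hi & Ei).
  apply computed_proj with (i := S (S i)). intros y. unfold lift. simpl.
  rewrite map_map, <- Ei.
  exact (map_nth (fun g : X -> nat => g (fst y)) gs (fun _ => 0) i).
Qed.
Hint Resolve computed_search : computed.

(** A search for a counterexample that finds none returns its bound. *)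
Definition all_below (P : nat -> bool) (n : nat) : bool :=
  search (fun c => negb (P c)) n =? n.

Lemma all_below_spec P n : all_below P n = true <-> forall m, m < n -> P m = true.
Proof.
  unfold all_below. destruct (search_spec (fun c => negb (P c)) n) as (L & H & M).
  rewrite Nat.eqb_eq. split.
  - intros E m Hm. rewrite E in M. apply M in Hm. now apply Bool.negb_false_iff in Hm.
  - intros A. destruct (Nat.eq_dec (search (fun c => negb (P c)) n) n) as [E|E]; [exact E|].
    assert (search (fun c => negb (P c)) n < n) as Hlt by lia.
    apply H in Hlt as H'. now rewrite A in H' by exact Hlt.
Qed.

Lemma computed_all_below {X} (gs : list (X -> nat)) (P : X -> nat -> bool) n :
  computed (snd :: lift gs) (fun y : X * nat => Nat.b2n (P (fst y) (snd y))) ->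
  computed gs n -> computed gs (fun x => Nat.b2n (all_below (fun c => P x c) (n x))).
Proof. intros HP Hn. unfold all_below. computed_tac. Qed.
Hint Resolve computed_all_below : computed.

(** * Pairs and lists *)

Lemma val2_spec fuel n :
  0 < n <= fuel ->
  n = 2 ^ fst (val2 fuel n) * snd (val2 fuel n) /\ Nat.even (snd (val2 fuel n)) = false.
Proof.
  revert n. induction fuel as [|fuel IH]; intros n Hn; [lia|]. simpl.
  assert (Nat.ltb 0 n = true) as -> by (apply Nat.ltb_lt; lia).
  destruct (Nat.even n) eqn:E; simpl; [|split; [lia|exact E]].
  pose proof (Nat.div2_odd n) as H. rewrite <- Nat.negb_even, E in H. simpl in H.
  destruct (IH (Nat.div2 n)) as [H1 H2]; [lia|].
  destruct (val2 fuel (Nat.div2 n)) as [a o]. simpl in *. split; [lia|exact H2].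
Qed.

Lemma pow2_odd_inj a b a' b' :
  2 ^ a * (2 * b + 1) = 2 ^ a' * (2 * b' + 1) -> a = a' /\ b = b'.
Proof.
  revert a'. induction a as [|a IH]; intros [|a'] H; simpl in H; try lia.
  destruct (IH a'); simpl in *; lia.
Qed.

Lemma pow2_pos n : 0 < 2 ^ n.
Proof. induction n; simpl; lia. Qed.

Definition pi1 (m : nat) : nat := fst (nunpair m).
Definition pi2 (m : nat) : nat := snd (nunpair m).

Lemma npair_pi m : npair (pi1 m) (pi2 m) = m.
Proof.
  unfold pi1, pi2, nunpair.
  destruct (val2_spec (S m) (S m)) as [H1 H2]; [lia|].
  destruct (val2 (S m) (S m)) as [a o]. simpl in H1, H2 |- *. unfold npair.
  pose proof (Nat.div2_odd o) as Ho. rewrite <- Nat.negb_even, H2 in Ho. simpl Nat.b2n in Ho.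
  rewrite <- Ho. lia.
Qed.

Lemma npair_inj a b a' b' : npair a b = npair a' b' -> a = a' /\ b = b'.
Proof.
  unfold npair. intros H. apply pow2_odd_inj.
  pose proof (pow2_pos a). pose proof (pow2_pos a').
  assert (0 < 2 ^ a * (2 * b + 1)) by (apply Nat.mul_pos_pos; lia).
  assert (0 < 2 ^ a' * (2 * b' + 1)) by (apply Nat.mul_pos_pos; lia).
  lia.
Qed.

Lemma pi1_npair a b : pi1 (npair a b) = a.
Proof. apply (npair_inj _ (pi2 (npair a b)) a b), npair_pi. Qed.

Lemma pi2_npair a b : pi2 (npair a b) = b.
Proof. apply (npair_inj (pi1 (npair a b)) _ a b), npair_pi. Qed.

Lemma npair_ge a b : a <= npair a b /\ b <= npair a b.
Proof.
  unfold npair. pose proof (Nat.pow_gt_lin_r 2 a ltac:(lia)) as H.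
  nia.
Qed.

Lemma pi1_le m : pi1 m <= m.
Proof. rewrite <- (npair_pi m) at 2. apply npair_ge. Qed.

Lemma pi2_le m : pi2 m <= m.
Proof. rewrite <- (npair_pi m) at 2. apply npair_ge. Qed.

Lemma computed_npair {X} (gs : list (X -> nat)) a b :
  computed gs a -> computed gs b -> computed gs (fun x => npair (a x) (b x)).
Proof. intros. unfold npair. computed_tac. Qed.
Hint Resolve computed_npair : computed.

(** Both components are at most the code, so the pairing is inverted by bounded search. The inner
    search returns its bound [S m] when it fails; the test against [S m] thus asks whether some [b]
    fits [a]. *)
Lemma computed_pi1 {X} (gs : list (X -> nat)) a :
  computed gs a -> computed gs (fun x => pi1 (a x)).
Proof.
  apply computed_comp1.
  apply computed_ext with
    (fun m => search (fun a => search (fun b => npair a b =? m) (S m) <? S m) (S m)).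
  - intros m. apply search_least.
    + pose proof (pi1_le m). lia.
    + rewrite (search_least _ _ (pi2 m)).
      * pose proof (pi2_le m). apply Nat.ltb_lt. lia.
      * pose proof (pi2_le m). lia.
      * apply Nat.eqb_eq, npair_pi.
      * intros b Hb. apply Nat.eqb_neq. intros E.
        rewrite <- (npair_pi m) in E at 2. apply npair_inj in E. lia.
    + intros a' Ha. apply Nat.ltb_ge.
      destruct (search_spec (fun b => npair a' b =? m) (S m)) as (_ & H & _).
      destruct (Nat.lt_ge_cases (search (fun b => npair a' b =? m) (S m)) (S m)) as [L|]; [|assumption].
      apply H, Nat.eqb_eq in L.
      rewrite <- (npair_pi m) in L at 2. apply npair_inj in L. lia.
  - computed_tac.
Qed.
Hint Resolve computed_pi1 : computed.

Lemma computed_pi2 {X} (gs : list (X -> nat)) a :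
  computed gs a -> computed gs (fun x => pi2 (a x)).
Proof.
  apply computed_comp1.
  apply computed_ext with (fun m => search (fun b => npair (pi1 m) b =? m) (S m)).
  - intros m. apply search_least.
    + pose proof (pi2_le m). lia.
    + apply Nat.eqb_eq, npair_pi.
    + intros b Hb. apply Nat.eqb_neq. intros E.
      rewrite <- (npair_pi m) in E at 2. apply npair_inj in E. lia.
  - computed_tac.
Qed.
Hint Resolve computed_pi2 : computed.

(** Since [pi2 0 = 0], the empty list [0] is its own tail, and reading past the end gives [0], which
    is also a code of the rational number 0. *)
Definition tail_code (i L : nat) : nat := primrec L (fun _ r => pi2 (pred r)) i.
Definition nth_code (L i : nat) : nat := pi1 (pred (tail_code i L)).

Lemma computed_tail_code {X} (gs : list (X -> nat)) i L :
  computed gs i -> computed gs L -> computed gs (fun x => tail_code (i x) (L x)).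
Proof. apply computed_comp2. unfold tail_code. computed_tac. Qed.
Hint Resolve computed_tail_code : computed.

Lemma computed_nth_code {X} (gs : list (X -> nat)) L i :
  computed gs L -> computed gs i -> computed gs (fun x => nth_code (L x) (i x)).
Proof. intros. unfold nth_code. computed_tac. Qed.
Hint Resolve computed_nth_code : computed.

Lemma tail_code_S i L : tail_code (S i) L = tail_code i (pi2 (pred L)).
Proof.
  unfold tail_code. induction i as [|i IH]; [reflexivity|].
  change (pi2 (pred (primrec L (fun _ r => pi2 (pred r)) (S i))) =
          pi2 (pred (primrec (pi2 (pred L)) (fun _ r => pi2 (pred r)) i))).
  now rewrite IH.
Qed.

Lemma tail_code_0 i : tail_code i 0 = 0.
Proof. induction i as [|i IH]; [reflexivity|]. rewrite tail_code_S. exact IH. Qed.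

Lemma nth_code_0 i : nth_code 0 i = 0.
Proof. unfold nth_code. now rewrite tail_code_0. Qed.

Lemma nth_code_S L i : nth_code L (S i) = nth_code (pi2 (pred L)) i.
Proof. unfold nth_code. now rewrite tail_code_S. Qed.

Lemma tail_code_list l i : tail_code i (code_list l) = code_list (skipn i l).
Proof.
  revert l. induction i as [|i IH]; intros l; [reflexivity|].
  rewrite tail_code_S. destruct l as [|a l]; [apply tail_code_0|].
  simpl. rewrite pi2_npair. apply IH.
Qed.

Lemma nth_code_list l i : nth_code (code_list l) i = nth i l 0.
Proof.
  revert i. induction l as [|a l IH]; intros i; simpl code_list.
  - rewrite nth_code_0. now destruct i.
  - destruct i as [|i].
    + apply pi1_npair.
    + rewrite nth_code_S. simpl pred. rewrite pi2_npair. apply IH.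
Qed.

(** Entries of a decoded list can be read off by [nth_code] because the code of a tail is smaller
    than that of the list, so the fuel suffices. The two bounds lead to the Lipschitz constant of a
    coded polynomial. *)
Lemma decl_spec fuel m :
  length (decl fuel m) <= fuel /\ (forall c, In c (decl fuel m) -> c <= m) /\
  (m <= fuel -> forall i, nth i (decl fuel m) 0 = nth_code m i).
Proof.
  revert m. induction fuel as [|fuel IH]; intros m.
  - simpl. split; [lia|]. split; [tauto|]. intros Hm i.
    replace m with 0 by lia. rewrite nth_code_0. now destruct i.
  - destruct m as [|m].
    + simpl. split; [lia|]. split; [tauto|]. intros _ i.
      rewrite nth_code_0. now destruct i.
    + simpl. pose proof (pi1_le m) as H1. pose proof (pi2_le m) as H2.
      destruct (nunpair m) as [a b] eqn:E.
      assert (pi1 m = a) as E1 by (unfold pi1; now rewrite E).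
      assert (pi2 m = b) as E2 by (unfold pi2; now rewrite E).
      rewrite E1 in H1. rewrite E2 in H2.
      destruct (IH b) as (L & I & N).
      split; [simpl; lia|]. split.
      * intros c [<-|Hc]; [lia|]. apply I in Hc. lia.
      * intros Hm [|i]; [symmetry; exact E1|].
        rewrite nth_code_S. simpl. rewrite E2. apply N. lia.
Qed.

Lemma computed_fun_intro f : computed [fun n : nat => n] f -> computable_fun f.
Proof. intros [P HP]. exists P. exact HP. Qed.

(** * Rational numbers *)

(** Code of [(p - n) / (d + 1)]. Signed numerators are kept as differences of naturals, so that
    rational arithmetic stays within [computed]; the parity matches [zdec], which puts negative
    integers at odd codes. *)
Definition mkQ (p n d : nat) : nat :=
  npair (if n <=? p then 2 * (p - n) else pred (2 * (n - p))) d.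
Definition posQ (c : nat) : nat := if Nat.even (pi1 c) then Nat.div2 (pi1 c) else 0.
Definition negQ (c : nat) : nat := if Nat.even (pi1 c) then 0 else Nat.div2 (S (pi1 c)).
Definition denQ (c : nat) : nat := S (pi2 c).

Definition addQ (c d : nat) : nat :=
  mkQ (posQ c * denQ d + posQ d * denQ c) (negQ c * denQ d + negQ d * denQ c)
    (pred (denQ c * denQ d)).
Definition subQ (c d : nat) : nat :=
  mkQ (posQ c * denQ d + negQ d * denQ c) (negQ c * denQ d + posQ d * denQ c)
    (pred (denQ c * denQ d)).
Definition mulQ (c d : nat) : nat :=
  mkQ (posQ c * posQ d + negQ c * negQ d) (posQ c * negQ d + negQ c * posQ d)
    (pred (denQ c * denQ d)).
Definition absQ (c : nat) : nat := mkQ (posQ c + negQ c) 0 (pi2 c).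
Definition ltQ (c d : nat) : bool :=
  posQ c * denQ d + negQ d * denQ c <? posQ d * denQ c + negQ c * denQ d.

Section RationalCodes.
Context {X : Type} (gs : list (X -> nat)).

Lemma computed_mkQ a b c : computed gs a -> computed gs b -> computed gs c ->
  computed gs (fun x => mkQ (a x) (b x) (c x)).
Proof. intros. unfold mkQ. computed_tac. Qed.

Lemma computed_posQ a : computed gs a -> computed gs (fun x => posQ (a x)).
Proof. intros. unfold posQ. computed_tac. Qed.

Lemma computed_negQ a : computed gs a -> computed gs (fun x => negQ (a x)).
Proof. intros. unfold negQ. computed_tac. Qed.

Lemma computed_denQ a : computed gs a -> computed gs (fun x => denQ (a x)).
Proof. intros. unfold denQ. computed_tac. Qed.

Hint Resolve computed_mkQ computed_posQ computed_negQ computed_denQ : computed.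

Lemma computed_addQ a b : computed gs a -> computed gs b ->
  computed gs (fun x => addQ (a x) (b x)).
Proof. intros. unfold addQ. computed_tac. Qed.

Lemma computed_subQ a b : computed gs a -> computed gs b ->
  computed gs (fun x => subQ (a x) (b x)).
Proof. intros. unfold subQ. computed_tac. Qed.

Lemma computed_mulQ a b : computed gs a -> computed gs b ->
  computed gs (fun x => mulQ (a x) (b x)).
Proof. intros. unfold mulQ. computed_tac. Qed.

Lemma computed_absQ a : computed gs a -> computed gs (fun x => absQ (a x)).
Proof. intros. unfold absQ. computed_tac. Qed.

Lemma computed_ltQ a b : computed gs a -> computed gs b ->
  computed gs (fun x => Nat.b2n (ltQ (a x) (b x))).
Proof. intros. unfold ltQ. computed_tac. Qed.
End RationalCodes.

Hint Resolve computed_mkQ computed_addQ computed_subQ computed_mulQ computed_absQ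
  computed_ltQ : computed.

Local Open Scope R_scope.

Lemma ratR_pos_neg c : ratR c = (INR (posQ c) - INR (negQ c)) / INR (denQ c).
Proof.
  unfold ratR, posQ, negQ, denQ, pi1, pi2. destruct (nunpair c) as [a b]. cbn [fst snd].
  f_equal. unfold zdec. destruct (Nat.even a).
  - rewrite <- INR_IZR_INZ. cbn [INR]. lra.
  - rewrite opp_IZR, <- INR_IZR_INZ. cbn [INR]. lra.
Qed.

Lemma posQ_mkQ p n d : posQ (mkQ p n d) = (p - n)%nat.
Proof.
  unfold posQ, mkQ. rewrite pi1_npair. destruct (Nat.leb_spec n p).
  - now rewrite Nat.even_even, Nat.div2_double.
  - replace (pred (2 * (n - p))) with (2 * (n - p - 1) + 1)%nat by lia.
    rewrite Nat.even_odd. lia.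
Qed.

Lemma negQ_mkQ p n d : negQ (mkQ p n d) = (n - p)%nat.
Proof.
  unfold negQ, mkQ. rewrite pi1_npair. destruct (Nat.leb_spec n p).
  - rewrite Nat.even_even. lia.
  - replace (pred (2 * (n - p))) with (2 * (n - p - 1) + 1)%nat by lia.
    rewrite Nat.even_odd.
    replace (S (2 * (n - p - 1) + 1)) with (2 * (n - p))%nat by lia.
    now rewrite Nat.div2_double.
Qed.

Lemma denQ_mkQ p n d : denQ (mkQ p n d) = S d.
Proof. unfold denQ, mkQ. now rewrite pi2_npair. Qed.

Lemma ratR_mkQ p n d : ratR (mkQ p n d) = (INR p - INR n) / INR (S d).
Proof.
  rewrite ratR_pos_neg, posQ_mkQ, negQ_mkQ, denQ_mkQ. f_equal.
  destruct (Nat.le_ge_cases n p) as [L|L].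
  - replace (n - p)%nat with 0%nat by lia. rewrite minus_INR by exact L. cbn [INR]. lra.
  - replace (p - n)%nat with 0%nat by lia. rewrite minus_INR by exact L. cbn [INR]. lra.
Qed.

Lemma denQ_pos c : 0 < INR (denQ c).
Proof. apply lt_0_INR. unfold denQ. lia. Qed.

Lemma INR_denQ_mul c d : INR (S (pred (denQ c * denQ d))) = INR (denQ c) * INR (denQ d).
Proof.
  rewrite <- mult_INR. reflexivity.
Qed.

Lemma ratR_addQ c d : ratR (addQ c d) = ratR c + ratR d.
Proof.
  unfold addQ. rewrite ratR_mkQ, INR_denQ_mul, !plus_INR, !mult_INR, (ratR_pos_neg c), (ratR_pos_neg d).
  pose proof (denQ_pos c). pose proof (denQ_pos d). field. lra.
Qed.

Lemma ratR_subQ c d : ratR (subQ c d) = ratR c - ratR d.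
Proof.
  unfold subQ. rewrite ratR_mkQ, INR_denQ_mul, !plus_INR, !mult_INR, (ratR_pos_neg c), (ratR_pos_neg d).
  pose proof (denQ_pos c). pose proof (denQ_pos d). field. lra.
Qed.

Lemma ratR_mulQ c d : ratR (mulQ c d) = ratR c * ratR d.
Proof.
  unfold mulQ. rewrite ratR_mkQ, INR_denQ_mul, !plus_INR, !mult_INR, (ratR_pos_neg c), (ratR_pos_neg d).
  pose proof (denQ_pos c). pose proof (denQ_pos d). field. lra.
Qed.

Lemma Rabs_ratR c : Rabs (ratR c) = (INR (posQ c) + INR (negQ c)) / INR (denQ c).
Proof.
  rewrite ratR_pos_neg. unfold Rdiv. rewrite Rabs_mult.
  pose proof (denQ_pos c) as D.
  rewrite (Rabs_right (/ _)) by (apply Rle_ge, Rlt_le, Rinv_0_lt_compat, D).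
  f_equal. unfold posQ, negQ. destruct (Nat.even (pi1 c)); cbn [INR].
  - rewrite Rminus_0_r, Rplus_0_r. apply Rabs_right, Rle_ge, pos_INR.
  - unfold Rminus. rewrite !Rplus_0_l, Rabs_Ropp. apply Rabs_right, Rle_ge, pos_INR.
Qed.

Lemma ratR_absQ c : ratR (absQ c) = Rabs (ratR c).
Proof.
  rewrite Rabs_ratR. unfold absQ. rewrite ratR_mkQ, plus_INR. cbn [INR].
  now rewrite Rminus_0_r.
Qed.

Lemma ltQ_spec c d : ltQ c d = true <-> ratR c < ratR d.
Proof.
  unfold ltQ. rewrite Nat.ltb_lt, (ratR_pos_neg c), (ratR_pos_neg d).
  pose proof (denQ_pos c) as C. pose proof (denQ_pos d) as D.
  set (x := INR (posQ c) - INR (negQ c)). set (y := INR (posQ d) - INR (negQ d)).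
  transitivity (x * INR (denQ d) < y * INR (denQ c)).
  - unfold x, y. split; intros H.
    + apply lt_INR in H. rewrite !plus_INR, !mult_INR in H. lra.
    + apply INR_lt. rewrite !plus_INR, !mult_INR. lra.
  - split; intros H.
    + apply (Rmult_lt_reg_r (INR (denQ c) * INR (denQ d))); [now apply Rmult_lt_0_compat|].
      field_simplify; lra.
    + apply (Rmult_lt_compat_r (INR (denQ c) * INR (denQ d))) in H; [|now apply Rmult_lt_0_compat].
      field_simplify in H; lra.
Qed.

Lemma ltQ_false c d : negb (ltQ c d) = true <-> ratR d <= ratR c.
Proof.
  rewrite Bool.negb_true_iff. split; intros H.
  - apply Rnot_lt_le. intros L. apply ltQ_spec in L. congruence.
  - destruct (ltQ c d) eqn:E; [|reflexivity]. apply ltQ_spec in E. lra.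
Qed.

Lemma ratR_0 : ratR 0 = 0.
Proof. unfold ratR. cbn. lra. Qed.

(** The numerator is at most its code and the denominator at least 1. This lets the code of a
    polynomial bound its coefficients. *)
Lemma Rabs_ratR_le c : Rabs (ratR c) <= INR c.
Proof.
  rewrite Rabs_ratR.
  assert (posQ c + negQ c <= c)%nat as H.
  { transitivity (pi1 c); [|apply pi1_le]. unfold posQ, negQ.
    pose proof (Nat.div2_odd (pi1 c)) as E.
    destruct (Nat.even (pi1 c)); [lia|].
    pose proof (Nat.div2_odd (S (pi1 c))). lia. }
  apply le_INR in H. rewrite plus_INR in H.
  assert (1 <= INR (denQ c)) as D by (apply (le_INR 1); unfold denQ; lia).
  pose proof (pos_INR (posQ c)). pose proof (pos_INR (negQ c)).
  apply (Rmult_le_reg_r (INR (denQ c))); [lra|]. unfold Rdiv.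
  rewrite Rmult_assoc, Rinv_l, Rmult_1_r by lra. nra.
Qed.

Lemma ratR_dense u v : u < v -> exists m, u < ratR m < v.
Proof.
  intros H. destruct (archimed_cor1 (v - u)) as (d & Hd & Hpos); [lra|].
  destruct d as [|d]; [lia|]. clear Hpos.
  assert (0 < INR (S d)) as D by (apply lt_0_INR; lia).
  destruct (archimed (u * INR (S d))) as [Z1 Z2]. set (z := up (u * INR (S d))) in *.
  exists (mkQ (Z.to_nat z) (Z.to_nat (- z)) d). rewrite ratR_mkQ.
  replace (INR (Z.to_nat z) - INR (Z.to_nat (- z))) with (IZR z).
  - split.
    + apply (Rmult_lt_reg_r (INR (S d))); [exact D|]. unfold Rdiv.
      rewrite Rmult_assoc, Rinv_l by lra. lra.
    + apply (Rmult_lt_reg_r (INR (S d))); [exact D|]. unfold Rdiv.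
      rewrite Rmult_assoc, Rinv_l by lra.
      apply (Rmult_lt_compat_r (INR (S d))) in Hd; [|exact D].
      rewrite Rinv_l in Hd by lra. lra.
  - rewrite !INR_IZR_INZ, <- minus_IZR. f_equal. lia.
Qed.

(** * The algorithm *)

Local Open Scope bool_scope.
Local Open Scope nat_scope.

Lemma computed_comp4 {X} (gs : list (X -> nat)) (g : nat -> nat -> nat -> nat -> nat) a b c d :
  computed [fun y : nat * nat * nat * nat => fst (fst (fst y)); fun y => snd (fst (fst y));
            fun y => snd (fst y); snd]
    (fun y => g (fst (fst (fst y))) (snd (fst (fst y))) (snd (fst y)) (snd y)) ->
  computed gs a -> computed gs b -> computed gs c -> computed gs d ->
  computed gs (fun x => g (a x) (b x) (c x) (d x)).
Proof.
  intros Hg Ha Hb Hc Hd.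
  apply (computed_subst gs _ _ (fun x => (a x, b x, c x, d x)) Hg). auto 6.
Qed.

(** Horner's rule from the last coefficient down. There are always [w] rounds, as [w] bounds the
    number of coefficients; missing ones read as zero. *)
Definition polyQ (w x : nat) : nat :=
  primrec 0 (fun j r => addQ (nth_code w (w - S j)) (mulQ x r)) w.

Lemma computed_polyQ {X} (gs : list (X -> nat)) w x :
  computed gs w -> computed gs x -> computed gs (fun u => polyQ (w u) (x u)).
Proof. apply computed_comp2. unfold polyQ. computed_tac. Qed.
Hint Resolve computed_polyQ : computed.

Definition pow2invQ (j : nat) : nat := mkQ 1 0 (pred (2 ^ j)).

(** The margin of twice [/ 2 ^ j] pays for the approximation errors at [u] and at [v]. *)
Definition below (w j u v : nat) : bool :=
  ltQ (addQ (absQ (polyQ w u)) (mulQ (mkQ 2 0 0) (pow2invQ j))) (absQ (polyQ w v)).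

(** The extra margin [s] pays for the variation of the polynomial over a cell. *)
Definition away (w j u s : nat) : bool :=
  ltQ (addQ (pow2invQ j) s) (absQ (polyQ w u)).

Definition grid (a b N i : nat) : nat := addQ a (mulQ (subQ b a) (mkQ i 0 (pred N))).

Definition split_ok (w j a b x y z : nat) : bool :=
  ltQ a y && ltQ y x && ltQ x z && ltQ z b &&
  below w j y a && below w j y x && below w j z x && below w j z b.

(* [w * w * w] is a Lipschitz constant on [0,1] of the polynomial with code [w]: the
   codes of its coefficients, which bound the coefficients, and their number are at most [w]. *)
Definition cell_ok (w j a b x y N i : nat) : bool :=
  away w j (grid a b N i) (mulQ (mkQ (w * w * w) 0 (pred N)) (subQ b a)) ||
  negb (ltQ (grid a b N i) x) && negb (ltQ y (grid a b N (S i))).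

(** Besides clearing the cells outside [[x,y]], it checks that [f] does not vanish at [x] and [y],
    which every later step relies on. *)
Definition shrink_ok (w j t a b x y N : nat) : bool :=
  negb (ltQ x a) && ltQ x y && negb (ltQ b y) && ltQ (subQ y x) (pow2invQ t) &&
  away w j x 0 && away w j y 0 && all_below (fun i => cell_ok w j a b x y N i) N.

Definition state (a b i : nat) : nat := npair a (npair b i).
Definition left_end (s : nat) : nat := pi1 s.
Definition right_end (s : nat) : nat := pi1 (pi2 s).
Definition choices (s : nat) : nat := pi2 (pi2 s).

Definition step_code (j x y z N : nat) : nat := npair j (npair x (npair y (npair z N))).
Definition cert_j (c : nat) : nat := pi1 c.
Definition cert_x (c : nat) : nat := pi1 (pi2 c).
Definition cert_y (c : nat) : nat := pi1 (pi2 (pi2 c)).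
Definition cert_z (c : nat) : nat := pi1 (pi2 (pi2 (pi2 c))).
Definition cert_N (c : nat) : nat := pi2 (pi2 (pi2 (pi2 c))).

(* A certificate [c] with [cert_N c = 0] splits the interval of [s] at [cert_x c], with
   witnesses [cert_y c] and [cert_z c] on the two sides; any other one shrinks the interval
   to [cert_x c, cert_y c]. *)
Definition certifies (w t s c : nat) : bool :=
  if cert_N c =? 0
  then split_ok w (cert_j c) (left_end s) (right_end s) (cert_x c) (cert_y c) (cert_z c)
  else shrink_ok w (cert_j c) t (left_end s) (right_end s) (cert_x c) (cert_y c) (cert_N c).

Definition next (s c : nat) : nat :=
  if cert_N c =? 0
  then if Nat.even (choices s)
       then state (left_end s) (cert_x c) (Nat.div2 (choices s))
       else state (cert_x c) (right_end s) (Nat.div2 (choices s))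
  else state (cert_x c) (cert_y c) (choices s).

(* [L] codes a list whose head is an output position and whose tail is a prefix of a name;
   the first conjunct says that the tail has more than [c] entries. *)
Definition valid (L t s c : nat) : bool :=
  (0 <? tail_code (S c) L) && certifies (nth_code L (S (cert_j c))) t s c.

(** The bound [L] suffices: a list is no longer than its code, and only certificates below the
    length of the prefix are valid. *)
Definition find_certificate (L t s : nat) : nat := search (fun c => valid L t s c) L.

Definition init (i : nat) : nat := state 0 (mkQ 1 0 0) i.

(* The value is [0] if the prefix coded by [L] is too short, and otherwise the successor of a
   state. *)
Definition run (L i T : nat) : nat :=
  primrec (S (init i))
    (fun t r => if (0 <? r) && valid L t (pred r) (find_certificate L t (pred r))
                then S (next (pred r) (find_certificate L t (pred r))) else 0) T.

(** Position [npair i m] asks for approximation [m] of coordinate [i]. From time [m] on, [D] steps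
    absorb the possible splits and one more ensures a shrinking. *)
Definition associate (D L : nat) : nat :=
  if 0 <? run L (pi1 (nth_code L 0)) (S (pi2 (nth_code L 0) + D))
  then S (left_end (pred (run L (pi1 (nth_code L 0)) (S (pi2 (nth_code L 0) + D)))))
  else 0.

Lemma computed_certifies {X} (gs : list (X -> nat)) w t s c :
  computed gs w -> computed gs t -> computed gs s -> computed gs c ->
  computed gs (fun x => Nat.b2n (certifies (w x) (t x) (s x) (c x))).
Proof.
  apply (computed_comp4 gs (fun w t s c => Nat.b2n (certifies w t s c))).
  apply computed_ext with
    (fun y => let w := fst (fst (fst y)) in let t := snd (fst (fst y)) in
       let s := snd (fst y) in let c := snd y in
       if cert_N c =? 0
       then Nat.b2n (split_ok w (cert_j c) (left_end s) (right_end s) (cert_x c) (cert_y c) (cert_z c))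
       else Nat.b2n (shrink_ok w (cert_j c) t (left_end s) (right_end s) (cert_x c) (cert_y c) (cert_N c))).
  - intros y. unfold certifies. now destruct (cert_N (snd y) =? 0).
  - unfold split_ok, shrink_ok, cell_ok, below, away, grid, pow2invQ, left_end, right_end,
      cert_j, cert_x, cert_y, cert_z, cert_N. cbv zeta. computed_tac.
Qed.
Hint Resolve computed_certifies : computed.

Lemma computed_run {X} (gs : list (X -> nat)) L i T :
  computed gs L -> computed gs i -> computed gs T ->
  computed gs (fun x => run (L x) (i x) (T x)).
Proof.
  intros HL Hi HT.
  apply (computed_comp4 gs (fun L i T _ => run L i T) L i T (fun _ => 0)); try assumption;
    [|computed_tac].
  unfold run, init, find_certificate, valid, next, state, left_end, right_end, choices,
      cert_j, cert_x, cert_y, cert_z, cert_N. computed_tac.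
Qed.
Hint Resolve computed_run : computed.

Lemma associate_computable D : computable_fun (associate D).
Proof.
  apply computed_fun_intro. unfold associate, left_end. computed_tac.
Qed.

(** * Soundness of certificates *)

Local Open Scope R_scope.

Lemma ratR_polyQ w x : ratR (polyQ w x) = poly_eval (decode_list w) (ratR x).
Proof.
  destruct (decl_spec w w) as (L & _ & N). fold (decode_list w) in L, N.
  specialize (N (le_n w)). unfold polyQ.
  set (h := fun j r => addQ (nth_code w (w - S j)) (mulQ x r)).
  assert (forall j, (j <= w)%nat ->
    ratR (primrec 0 h j) = poly_eval (skipn (w - j) (decode_list w)) (ratR x)) as H.
  { induction j as [|j IH]; intros Hj.
    - rewrite Nat.sub_0_r, skipn_all2 by exact L. exact ratR_0.
    - change (primrec 0 h (S j)) with (h j (primrec 0 h j)). unfold h at 1.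
      rewrite ratR_addQ, ratR_mulQ, IH by lia. rewrite <- N.
      replace (w - j)%nat with (S (w - S j)) by lia.
      generalize (w - S j)%nat as i. intros i.
      generalize (decode_list w) as l. clear. induction i as [|i IH]; intros [|c l].
      + simpl. rewrite ratR_0. lra.
      + reflexivity.
      + simpl. rewrite ratR_0. lra.
      + apply (IH l). }
  rewrite H by lia. now rewrite Nat.sub_diag.
Qed.

Lemma poly_eval_bound l W x :
  0 <= x <= 1 -> (forall c, In c l -> Rabs (ratR c) <= W) ->
  Rabs (poly_eval l x) <= W * INR (length l).
Proof.
  intros Hx. induction l as [|c l IH]; intros H.
  - simpl. rewrite Rabs_R0. lra.
  - change (poly_eval (c :: l) x) with (ratR c + x * poly_eval l x).
    change (length (c :: l)) with (S (length l)). rewrite S_INR.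
    eapply Rle_trans; [apply Rabs_triang|]. rewrite Rabs_mult, (Rabs_right x) by lra.
    assert (Rabs (ratR c) <= W) by (apply H; now left).
    assert (Rabs (poly_eval l x) <= W * INR (length l)) by (apply IH; intros; apply H; now right).
    pose proof (Rabs_pos (poly_eval l x)). nra.
Qed.

(** One Horner step adds at most [W * n] to the constant [W * n * n], where [n] is the length of the
    tail, and the sum stays below [W * (n + 1) * (n + 1)]. *)
Lemma poly_eval_lipschitz l W x y :
  0 <= x <= 1 -> 0 <= y <= 1 -> 0 <= W -> (forall c, In c l -> Rabs (ratR c) <= W) ->
  Rabs (poly_eval l x - poly_eval l y) <= W * (INR (length l) * INR (length l)) * Rabs (x - y).
Proof.
  intros Hx Hy HW. induction l as [|c l IH]; intros H.
  - simpl. rewrite Rminus_diag, Rabs_R0. lra.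
  - change (poly_eval (c :: l) x) with (ratR c + x * poly_eval l x).
    change (poly_eval (c :: l) y) with (ratR c + y * poly_eval l y).
    change (length (c :: l)) with (S (length l)). rewrite S_INR.
    replace (ratR c + x * poly_eval l x - (ratR c + y * poly_eval l y))
      with (poly_eval l x * (x - y) + y * (poly_eval l x - poly_eval l y)) by ring.
    eapply Rle_trans; [apply Rabs_triang|]. rewrite !Rabs_mult, (Rabs_right y) by lra.
    assert (Rabs (poly_eval l x) <= W * INR (length l))
      by (apply poly_eval_bound; [exact Hx|]; intros; apply H; now right).
    assert (Rabs (poly_eval l x - poly_eval l y) <=
      W * (INR (length l) * INR (length l)) * Rabs (x - y))
      by (apply IH; intros; apply H; now right).
    pose proof (Rabs_pos (x - y)). pose proof (pos_INR (length l)) as Hl.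
    pose proof (Rabs_pos (poly_eval l x - poly_eval l y)).
    set (n := INR (length l)) in *. set (d := Rabs (x - y)) in *.
    apply Rle_trans with (W * n * d + W * (n * n) * d).
    + apply Rplus_le_compat; [now apply Rmult_le_compat_r|].
      eapply Rle_trans; [|exact H1].
      eapply Rle_trans; [apply (Rmult_le_compat_r _ y 1); lra|]. lra.
    + assert (0 <= W * d) by now apply Rmult_le_pos.
      assert (0 <= W * d * n) by now apply Rmult_le_pos. lra.
Qed.

Lemma polyQ_lipschitz w u v :
  0 <= ratR u <= 1 -> 0 <= v <= 1 ->
  Rabs (ratR (polyQ w u) - poly_eval (decode_list w) v)
    <= INR (w * w * w) * Rabs (ratR u - v).
Proof.
  intros Hu Hv. rewrite ratR_polyQ.
  destruct (decl_spec w w) as (L & I & _). fold (decode_list w) in L, I.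
  eapply Rle_trans.
  { apply (poly_eval_lipschitz _ (INR w)); [exact Hu|exact Hv|apply pos_INR|].
    intros c Hc. eapply Rle_trans; [apply Rabs_ratR_le|]. apply le_INR, I, Hc. }
  apply Rmult_le_compat_r; [apply Rabs_pos|].
  rewrite <- !mult_INR. apply le_INR.
  rewrite <- Nat.mul_assoc. apply Nat.mul_le_mono_l, Nat.mul_le_mono; exact L.
Qed.

Lemma ratR_pow2invQ j : ratR (pow2invQ j) = / 2 ^ j.
Proof.
  unfold pow2invQ. rewrite ratR_mkQ. pose proof (pow2_pos j).
  replace (S (pred (2 ^ j))) with (2 ^ j)%nat by lia.
  rewrite pow_INR. simpl INR. unfold Rdiv. rewrite Rminus_0_r. now rewrite Rmult_1_l.
Qed.

Lemma ratR_one : ratR (mkQ 1 0 0) = 1.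
Proof. rewrite ratR_mkQ. simpl. lra. Qed.

Lemma ratR_grid a b N i : (0 < N)%nat ->
  ratR (grid a b N i) = ratR a + (ratR b - ratR a) * (INR i / INR N).
Proof.
  intros HN. unfold grid. rewrite ratR_addQ, ratR_mulQ, ratR_subQ, ratR_mkQ.
  replace (S (pred N)) with N by lia. simpl (INR 0). now rewrite Rminus_0_r.
Qed.

Lemma grid_in_interval a b N i : (0 < N)%nat -> (i <= N)%nat -> ratR a <= ratR b ->
  ratR a <= ratR (grid a b N i) <= ratR b.
Proof.
  intros HN Hi H. rewrite ratR_grid by exact HN.
  apply lt_0_INR in HN. apply le_INR in Hi. pose proof (pos_INR i).
  assert (0 <= INR i / INR N <= 1).
  { split; [apply Rle_mult_inv_pos; lra|]. apply (Rmult_le_reg_r (INR N)); [lra|].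
    unfold Rdiv. rewrite Rmult_assoc, Rinv_l by lra. lra. }
  nra.
Qed.

Lemma grid_cover a b N z : (0 < N)%nat -> ratR a <= z <= ratR b ->
  exists i, (i < N)%nat /\ ratR (grid a b N i) <= z <= ratR (grid a b N (S i)).
Proof.
  intros HN Hz.
  assert (forall m, (m <= N)%nat -> ratR a <= z <= ratR (grid a b N m) -> (m = 0)%nat \/
    exists i, (i < N)%nat /\ ratR (grid a b N i) <= z <= ratR (grid a b N (S i))) as H.
  { induction m as [|m IH]; intros Hm Hzm; [now left|right].
    destruct (Rle_lt_dec (ratR (grid a b N m)) z) as [L|L].
    - exists m. split; [lia|]. lra.
    - destruct IH as [->|E]; [lia|lra| |exact E].
      rewrite ratR_grid in L by exact HN. simpl in L. unfold Rdiv in L.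
      rewrite Rmult_0_l, Rmult_0_r in L. lra. }
  assert (ratR (grid a b N N) = ratR b) as E.
  { rewrite ratR_grid by exact HN. apply lt_0_INR in HN. field. lra. }
  destruct (H N) as [H0|H0]; [lia|rewrite E; exact Hz|lia|exact H0].
Qed.

Section Soundness.
Context (p : Baire) (f : R -> R) (name : name_C p f).

Lemma polyQ_approx j u : 0 <= ratR u <= 1 ->
  Rabs (f (ratR u) - ratR (polyQ (p j) u)) <= / 2 ^ j.
Proof. intros H. rewrite ratR_polyQ. now apply name. Qed.

Lemma below_sound j u v : 0 <= ratR u <= 1 -> 0 <= ratR v <= 1 ->
  below (p j) j u v = true -> Rabs (f (ratR u)) < Rabs (f (ratR v)).
Proof.
  intros Hu Hv H. unfold below in H.
  rewrite ltQ_spec, ratR_addQ, ratR_mulQ, !ratR_absQ, ratR_pow2invQ, ratR_mkQ in H.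
  simpl (INR _) in H.
  pose proof (polyQ_approx j u Hu) as Au. pose proof (polyQ_approx j v Hv) as Av.
  set (e := / 2 ^ j) in *. split_Rabs; lra.
Qed.

Lemma away_sound j u : 0 <= ratR u <= 1 -> away (p j) j u 0 = true -> f (ratR u) <> 0.
Proof.
  intros Hu H E. unfold away in H.
  rewrite ltQ_spec, ratR_addQ, ratR_absQ, ratR_pow2invQ, ratR_0 in H.
  pose proof (polyQ_approx j u Hu) as Au. rewrite E in Au.
  set (e := / 2 ^ j) in *. split_Rabs; lra.
Qed.

Lemma cell_ok_sound j a b x y N i z :
  0 <= ratR a -> ratR a <= ratR b -> ratR b <= 1 -> (i < N)%nat ->
  ratR (grid a b N i) <= z <= ratR (grid a b N (S i)) ->
  cell_ok (p j) j a b x y N i = true -> f z = 0 -> ratR x <= z <= ratR y.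
Proof.
  intros Ha Hab Hb Hi Hz H E. unfold cell_ok in H.
  apply Bool.orb_prop in H as [H|H].
  (* At a zero of [f] the polynomial is at most [/ 2 ^ j] in absolute value, so at the left grid
     point it cannot exceed this plus its variation over the cell. *)
  - exfalso. unfold away in H.
    rewrite ltQ_spec, ratR_addQ, ratR_absQ, ratR_pow2invQ, ratR_mulQ, ratR_mkQ, ratR_subQ in H.
    replace (S (pred N)) with N in H by lia. simpl (INR 0) in H. rewrite Rminus_0_r in H.
    destruct (grid_in_interval a b N i) as [G1 G2]; [lia|lia|lra|].
    destruct (grid_in_interval a b N (S i)) as [G3 G4]; [lia|lia|lra|].
    assert (0 <= z <= 1) as Hz1 by lra.
    pose proof (polyQ_lipschitz (p j) (grid a b N i) z ltac:(lra) Hz1) as Lip.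
    pose proof (name j z Hz1) as Az. rewrite E in Az.
    rewrite (Rabs_left1 (_ - z)) in Lip by lra.
    rewrite !ratR_grid in Hz by lia.
    assert (z - ratR (grid a b N i) <= (ratR b - ratR a) / INR N) as W.
    { rewrite ratR_grid by lia. rewrite S_INR in Hz.
      assert (0 < INR N) by (apply lt_0_INR; lia).
      replace ((ratR b - ratR a) * ((INR i + 1) / INR N)) with
        ((ratR b - ratR a) * (INR i / INR N) + (ratR b - ratR a) / INR N) in Hz by (field; lra).
      lra. }
    apply (Rmult_le_compat_l (INR (p j * p j * p j))) in W; [|apply pos_INR].
    replace (INR (p j * p j * p j) / INR N * (ratR b - ratR a)) with
      (INR (p j * p j * p j) * ((ratR b - ratR a) / INR N)) in H by (unfold Rdiv; ring).
    set (e := / 2 ^ j) in *.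
    split_Rabs; lra.
  - apply andb_prop in H as [H1 H2]. apply ltQ_false in H1, H2. lra.
Qed.

Lemma split_ok_sound j a b x y z : 0 <= ratR a -> ratR b <= 1 ->
  split_ok (p j) j a b x y z = true ->
  ratR a < ratR y < ratR x /\ ratR x < ratR z < ratR b /\
  Rabs (f (ratR y)) < Rabs (f (ratR a)) /\ Rabs (f (ratR y)) < Rabs (f (ratR x)) /\
  Rabs (f (ratR z)) < Rabs (f (ratR x)) /\ Rabs (f (ratR z)) < Rabs (f (ratR b)).
Proof.
  intros Ha Hb H. unfold split_ok in H.
  repeat (apply andb_prop in H; destruct H as [H ?H]).
  repeat match goal with h : ltQ _ _ = true |- _ => apply ltQ_spec in h end.
  repeat match goal with h : below _ _ _ _ = true |- _ => apply below_sound in h; try lra end.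
Qed.

Lemma shrink_ok_sound j t a b x y N : 0 <= ratR a -> ratR a < ratR b -> ratR b <= 1 ->
  (0 < N)%nat -> shrink_ok (p j) j t a b x y N = true ->
  ratR a <= ratR x /\ ratR x < ratR y /\ ratR y <= ratR b /\ ratR y - ratR x < / 2 ^ t /\
  f (ratR x) <> 0 /\ f (ratR y) <> 0 /\
  forall z, ratR a <= z <= ratR b -> f z = 0 -> ratR x <= z <= ratR y.
Proof.
  intros Ha Hab Hb HN H. unfold shrink_ok in H.
  apply andb_prop in H as [H H7]. apply andb_prop in H as [H H6].
  apply andb_prop in H as [H H5]. apply andb_prop in H as [H H4].
  apply andb_prop in H as [H H3]. apply andb_prop in H as [H1 H2].
  apply ltQ_false in H1, H3. apply ltQ_spec in H2, H4.
  rewrite ratR_subQ, ratR_pow2invQ in H4.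
  apply away_sound in H5; [|lra]. apply away_sound in H6; [|lra].
  do 6 (split; [assumption|]). intros z Hz E.
  destruct (grid_cover a b N z HN Hz) as (i & Hi & Gi).
  apply (cell_ok_sound j a b x y N i z); try assumption; try lra.
  now apply (proj1 (all_below_spec _ N) H7).
Qed.
End Soundness.

(** * Dips and local minima *)

(** Composing with this retraction onto [[0,1]] turns one-sided continuity at 0 and 1 into two-sided
    continuity on the line, as the extreme value theorem requires. *)
Definition clamp (x : R) : R := Rmax 0 (Rmin 1 x).

Lemma clamp_in x : 0 <= clamp x <= 1.
Proof. unfold clamp, Rmax, Rmin. repeat destruct (Rle_dec _ _); lra. Qed.

Lemma clamp_id x : 0 <= x <= 1 -> clamp x = x.
Proof. unfold clamp, Rmax, Rmin. intros. repeat destruct (Rle_dec _ _); lra. Qed.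

Lemma clamp_lipschitz x y : Rabs (clamp x - clamp y) <= Rabs (x - y).
Proof.
  unfold clamp, Rmax, Rmin. repeat destruct (Rle_dec _ _); split_Rabs; lra.
Qed.

Lemma cont01_min f u v : cont01 f -> 0 <= u -> u <= v -> v <= 1 ->
  exists m, u <= m <= v /\ forall x, u <= x <= v -> f m <= f x.
Proof.
  intros C Hu Huv Hv.
  destruct (continuity_ab_min (fun x => f (clamp x)) u v Huv) as (m & Hm & Hmuv).
  - intros c _ eps Heps.
    destruct (C (clamp c) (clamp_in c) eps Heps) as (d & Hd & H).
    exists d. split; [exact Hd|]. intros x [_ Hx]. apply H; [apply clamp_in|].
    eapply Rle_lt_trans; [apply clamp_lipschitz|exact Hx].
  - exists m. split; [exact Hmuv|]. intros x Hx.
    specialize (Hm x Hx). simpl in Hm. rewrite !clamp_id in Hm by lra. exact Hm.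
Qed.

Lemma cont01_Rabs f : cont01 f -> cont01 (fun x => Rabs (f x)).
Proof.
  intros C x Hx eps Heps. destruct (C x Hx eps Heps) as (d & Hd & H).
  exists d. split; [exact Hd|]. intros y Hy Hyx.
  eapply Rle_lt_trans; [apply Rabs_triang_inv2|]. now apply H.
Qed.

(** The minimum over [[a,b]] is attained, and not at an end since [m] lies lower. *)
Lemma valley_local_min f a m b : cont01 f -> 0 <= a -> a < m < b -> b <= 1 ->
  f m < f a -> f m < f b -> exists x, a < x < b /\ local_min f x.
Proof.
  intros C Ha Hm Hb Ham Hbm.
  destruct (cont01_min f a b C) as (x & Hx & Min); try lra.
  pose proof (Min m ltac:(lra)) as Mm.
  assert (x <> a) by (intros ->; lra). assert (x <> b) by (intros ->; lra).
  exists x. split; [lra|]. split; [lra|].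
  exists (Rmin (x - a) (b - x)). split.
  - apply Rmin_glb_lt; lra.
  - intros y _ Hy. apply Min.
    pose proof (Rmin_l (x - a) (b - x)). pose proof (Rmin_r (x - a) (b - x)).
    split_Rabs; lra.
Qed.

Lemma nonzero_bounded_away f u v : cont01 f -> 0 <= u -> u <= v -> v <= 1 ->
  (forall x, u <= x <= v -> f x <> 0) ->
  exists mu, 0 < mu /\ forall x, u <= x <= v -> mu <= Rabs (f x).
Proof.
  intros C Hu Huv Hv H.
  destruct (cont01_min _ u v (cont01_Rabs f C) Hu Huv Hv) as (m & Hm & Min).
  exists (Rabs (f m)). split; [|exact Min]. apply Rabs_pos_lt, H, Hm.
Qed.

Lemma open_interval_avoids_list (l : list R) u v : u < v ->
  exists x, u < x < v /\ ~ In x l.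
Proof.
  intros Huv.
  assert (exists u' v', u <= u' /\ u' < v' /\ v' <= v /\ forall x, u' < x < v' -> ~ In x l)
    as (u' & v' & H1 & H2 & H3 & H4).
  { induction l as [|a l (u' & v' & H1 & H2 & H3 & H4)].
    - exists u, v. repeat split; try lra. intros x _ [].
    - destruct (Rlt_dec u' a) as [L|L].
      + exists u', (Rmin a v'). repeat split; [lra|now apply Rmin_glb_lt| |].
        * eapply Rle_trans; [apply Rmin_r|exact H3].
        * intros x Hx. pose proof (Rmin_l a v'). pose proof (Rmin_r a v').
          intros [->|Hin]; [lra|]. apply (H4 x); [lra|exact Hin].
      + exists u', v'. repeat split; [lra|lra|lra|].
        intros x Hx [->|Hin]; [lra|]. exact (H4 x Hx Hin). }
  exists ((u' + v') / 2). split; [lra|]. apply H4. lra.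
Qed.

(** If [f] vanished throughout, every point in between would be a local minimum, and no finite list
    holds them all. *)
Lemma nonzero_between n f z1 z2 : at_most_n_local_minima n f ->
  0 <= z1 -> z1 < z2 -> z2 <= 1 -> exists d, z1 < d < z2 /\ f d <> 0.
Proof.
  intros (l & _ & Hl) H1 H12 H2.
  destruct (open_interval_avoids_list l z1 z2 H12) as (x & Hx & Hin).
  assert (~ local_min f x) as Hloc by (intros Hm; apply Hin, Hl, Hm).
  apply Classical_Prop.NNPP. intros Hno. apply Hloc. split; [lra|].
  assert (forall y, z1 < y < z2 -> f y = 0) as Z.
  { intros y Hy. apply Classical_Prop.NNPP. intros Hy0. apply Hno. now exists y. }
  exists (Rmin (x - z1) (z2 - x)). split.
  - apply Rmin_glb_lt; lra.
  - intros y _ Hy.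
    pose proof (Rmin_l (x - z1) (z2 - x)). pose proof (Rmin_r (x - z1) (z2 - x)).
    rewrite (Z x), (Z y); [lra| |lra]. split_Rabs; lra.
Qed.

Lemma rational_approx f u x v eps : cont01 f -> 0 <= u -> u < x < v -> v <= 1 -> 0 < eps ->
  exists m, u < ratR m < v /\ Rabs (f (ratR m) - f x) < eps.
Proof.
  intros C Hu Hx Hv Heps. destruct (C x ltac:(lra) eps Heps) as (d & Hd & H).
  destruct (ratR_dense x (Rmin v (x + d))) as (m & Hm).
  - apply Rmin_glb_lt; lra.
  - pose proof (Rmin_l v (x + d)). pose proof (Rmin_r v (x + d)).
    exists m. split; [lra|]. apply H; [lra|]. rewrite Rabs_right; lra.
Qed.

(** Consecutive dips may share an end: the two dips produced by a split meet at the splitting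
    point. *)
Inductive dips (f : R -> R) : nat -> R -> R -> Prop :=
| dips_0 a b : a <= b -> dips f 0 a b
| dips_S k a u c v b :
    a <= u -> u < c < v -> Rabs (f c) < Rabs (f u) -> Rabs (f c) < Rabs (f v) ->
    dips f k v b -> dips f (S k) a b.

Lemma dips_le f k a b : dips f k a b -> a <= b.
Proof. induction 1; lra. Qed.

Lemma dips_widen f k a b a' b' : dips f k a b -> a' <= a -> b <= b' -> dips f k a' b'.
Proof.
  intros H. revert a'. induction H as [a b H|k a u c v b H1 H2 H3 H4 H IH]; intros a' Ha Hb.
  - constructor. lra.
  - apply (dips_S f k a' u c v); try assumption; [lra|]. apply IH; lra.
Qed.

Lemma dips_app f k k' a d b : dips f k a d -> dips f k' d b -> dips f (k + k') a b.
Proof.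
  intros H H'. induction H as [a d H|k a u c v d H1 H2 H3 H4 H IH]; simpl.
  - now apply dips_widen with d b; [|assumption|lra].
  - apply (dips_S f _ a u c v); auto.
Qed.

Lemma dips_fewer f k k' a b : dips f k a b -> (k' <= k)%nat -> dips f k' a b.
Proof.
  intros H. revert k'.
  induction H as [a b H|k a u c v b H1 H2 H3 H4 H IH]; intros [|k'] Hk.
  - now constructor.
  - lia.
  - constructor. apply dips_le in H. lra.
  - apply (dips_S f k' a u c v); try assumption. apply IH. lia.
Qed.

(** With the next lemma, this turns an inequality about [|f|] at the end of a dip into one about
    [f], once the sign of [f] at that end is known. *)
Lemma Rabs_lt_neg x y : Rabs x < Rabs y -> y < 0 -> y < x.
Proof. split_Rabs; lra. Qed.

Lemma Rabs_lt_pos x y : Rabs x < Rabs y -> 0 < y -> x < y.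
Proof. split_Rabs; lra. Qed.

(* In every case some point lies strictly below one on each side of it: [f] takes the signs
   +,-,+ at ends of dips, or is positive at both ends of a dip, or is negative at the facing
   ends of two consecutive dips. *)
Lemma three_dips_local_min f u1 c1 v1 u2 c2 v2 u3 c3 v3 :
  cont01 f -> 0 <= u1 -> v3 <= 1 ->
  u1 < c1 < v1 -> v1 <= u2 -> u2 < c2 < v2 -> v2 <= u3 -> u3 < c3 < v3 ->
  Rabs (f c1) < Rabs (f u1) -> Rabs (f c1) < Rabs (f v1) ->
  Rabs (f c2) < Rabs (f u2) -> Rabs (f c2) < Rabs (f v2) ->
  Rabs (f c3) < Rabs (f u3) -> Rabs (f c3) < Rabs (f v3) ->
  exists x, u1 < x < v3 /\ local_min f x.
Proof.
  intros C H0 H1 A1 A2 A3 A4 A5 L1 R1 L2 R2 L3 R3.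
  assert (forall a m b, u1 <= a -> a < m < b -> b <= v3 -> f m < f a -> f m < f b ->
    exists x, u1 < x < v3 /\ local_min f x) as V.
  { intros a m b Ha Hm Hb Fa Fb.
    destruct (valley_local_min f a m b C) as (x & Hx & Hmin); try lra.
    exists x. split; [lra|exact Hmin]. }
  pose proof (fun c x => Rabs_lt_neg (f c) (f x)) as Neg.
  pose proof (fun c x => Rabs_lt_pos (f c) (f x)) as Pos.
  assert (forall c x, Rabs (f c) < Rabs (f x) -> f x < 0 \/ 0 < f x) as Sgn.
  { intros c x Hcx. destruct (Rtotal_order (f x) 0) as [?|[E|?]]; auto.
    rewrite E, Rabs_R0 in Hcx. pose proof (Rabs_pos (f c)). lra. }
  assert (f v2 < 0 -> f u3 < 0 -> exists x, u1 < x < v3 /\ local_min f x) as NegNeg.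
  { intros Hv Hu. pose proof (Neg _ _ R2 Hv). pose proof (Neg _ _ L3 Hu).
    destruct (Rle_dec (f v2) (f u3)).
    - apply (V c2 v2 c3); lra.
    - apply (V c2 u3 c3); lra. }
  destruct (Sgn _ _ L2) as [U2|U2]; destruct (Sgn _ _ R2) as [V2|V2].
  - destruct (Sgn _ _ R1) as [V1|V1].
    + pose proof (Neg _ _ R1 V1). pose proof (Neg _ _ L2 U2).
      destruct (Rle_dec (f v1) (f u2)).
      * apply (V c1 v1 c2); lra.
      * apply (V c1 u2 c2); lra.
    + destruct (Sgn _ _ L3) as [U3|U3]; [now apply NegNeg|].
      apply (V v1 v2 u3); try lra. split; [lra|].
      (* The dips do not share this end, because [f] has opposite signs at [v2] and [u3]. *)
      destruct A4 as [A4|A4]; [exact A4|rewrite A4 in V2; lra].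
  - destruct (Sgn _ _ R1) as [V1|V1].
    + pose proof (Neg _ _ R1 V1). pose proof (Neg _ _ L2 U2).
      destruct (Rle_dec (f v1) (f u2)).
      * apply (V c1 v1 c2); lra.
      * apply (V c1 u2 c2); lra.
    + apply (V v1 u2 v2); try lra. split; [|lra].
      destruct A2 as [A2|A2]; [exact A2|rewrite A2 in V1; lra].
  - destruct (Sgn _ _ L3) as [U3|U3]; [now apply NegNeg|].
    apply (V u2 v2 u3); try lra. split; [lra|].
    destruct A4 as [A4|A4]; [exact A4|rewrite A4 in V2; lra].
  - pose proof (Pos _ _ L2 U2). pose proof (Pos _ _ R2 V2).
    apply (V u2 c2 v2); lra.
Qed.

(** Dips taken in consecutive threes yield minima in disjoint open intervals, hence distinct
    ones. *)
Lemma dips_local_minima f m a b : cont01 f -> dips f (3 * m) a b -> 0 <= a -> b <= 1 ->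
  exists l, length l = m /\ NoDup l /\ forall x, In x l -> a < x < b /\ local_min f x.
Proof.
  intros C. revert a. induction m as [|m IH]; intros a H Ha Hb.
  - exists nil. split; [reflexivity|]. split; [constructor|intros x []].
  - replace (3 * S m)%nat with (S (S (S (3 * m)))) in H by lia.
    inversion H as [|? ? u1 c1 v1 ? ? ? ? ? G1]; subst.
    inversion G1 as [|? ? u2 c2 v2 ? ? ? ? ? G2]; subst.
    inversion G2 as [|? ? u3 c3 v3 ? ? ? ? ? G3]; subst.
    pose proof (dips_le _ _ _ _ G3).
    destruct (three_dips_local_min f u1 c1 v1 u2 c2 v2 u3 c3 v3) as (x & Hx & Hmin);
      try assumption; try lra.
    destruct (IH v3 G3) as (l & Hl & ND & Hin); [lra|exact Hb|].
    exists (x :: l). split; [simpl; now rewrite Hl|]. split.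
    + constructor; [|exact ND]. intros Hxl. apply Hin in Hxl. lra.
    + intros y [<-|Hy]; [split; [lra|exact Hmin]|].
      apply Hin in Hy. split; [lra|apply Hy].
Qed.

Lemma dips_bound n f k a b : cont01 f -> at_most_n_local_minima n f ->
  0 <= a -> b <= 1 -> dips f k a b -> (k <= 3 * n + 2)%nat.
Proof.
  intros C (l & Hl & Hmin) Ha Hb H.
  destruct (Nat.le_gt_cases k (3 * n + 2)) as [L|L]; [exact L|].
  apply (dips_fewer f k (3 * S n)) in H; [|lia].
  destruct (dips_local_minima f (S n) a b C H Ha Hb) as (l' & Hl' & ND & Hin).
  assert (incl l' l) as I by (intros x Hx; apply Hmin, Hin, Hx).
  pose proof (NoDup_incl_length ND I). lia.
Qed.

(** * Existence of certificates *)

Lemma pow2inv_small eps : 0 < eps -> exists j, / 2 ^ j < eps.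
Proof.
  intros H. destruct (archimed_cor1 eps H) as (j & Hj & Hpos). exists j.
  eapply Rlt_trans; [|exact Hj]. apply Rinv_lt_contravar.
  - apply Rmult_lt_0_compat; [now apply lt_0_INR|apply pow_lt; lra].
  - pose proof (Nat.pow_gt_lin_r 2 j ltac:(lia)) as L. apply lt_INR in L.
    rewrite pow_INR in L. exact L.
Qed.

Lemma inv_INR_small K eps : 0 <= K -> 0 < eps ->
  exists N, (0 < N)%nat /\ K / INR N < eps /\ / INR N < eps.
Proof.
  intros HK Heps. destruct (archimed_cor1 (eps / (K + 1))) as (N & H & HN).
  - apply Rdiv_lt_0_compat; lra.
  - exists N. split; [exact HN|]. apply lt_0_INR in HN.
    pose proof (Rinv_0_lt_compat _ HN) as I.
    apply (Rmult_lt_compat_r (K + 1)) in H; [|lra].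
    unfold Rdiv in *. rewrite Rmult_assoc, Rinv_l, Rmult_1_r in H by lra. split; nra.
Qed.

Section Progress.
Context (p : Baire) (f : R -> R) (name : name_C p f) (cont : cont01 f).

Lemma below_complete j u v : 0 <= ratR u <= 1 -> 0 <= ratR v <= 1 ->
  Rabs (f (ratR u)) + 4 * / 2 ^ j < Rabs (f (ratR v)) -> below (p j) j u v = true.
Proof.
  intros Hu Hv H. unfold below.
  rewrite ltQ_spec, ratR_addQ, ratR_mulQ, !ratR_absQ, ratR_pow2invQ, ratR_mkQ.
  simpl (INR _).
  pose proof (polyQ_approx p f name j u Hu). pose proof (polyQ_approx p f name j v Hv).
  set (e := / 2 ^ j) in *. split_Rabs; lra.
Qed.

Lemma away_complete j u s : 0 <= ratR u <= 1 ->
  2 * / 2 ^ j + ratR s < Rabs (f (ratR u)) -> away (p j) j u s = true.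
Proof.
  intros Hu H. unfold away.
  rewrite ltQ_spec, ratR_addQ, ratR_absQ, ratR_pow2invQ.
  pose proof (polyQ_approx p f name j u Hu).
  set (e := / 2 ^ j) in *. split_Rabs; lra.
Qed.

Lemma split_exists n a b z1 z2 : at_most_n_local_minima n f ->
  0 <= ratR a -> ratR b <= 1 -> f (ratR a) <> 0 -> f (ratR b) <> 0 ->
  ratR a <= z1 -> z1 < z2 -> z2 <= ratR b -> f z1 = 0 -> f z2 = 0 ->
  exists j x y z, split_ok (p j) j a b x y z = true.
Proof.
  intros Hmin Ha Hb Fa Fb H1 H12 H2 Z1 Z2.
  assert (ratR a <> z1) by congruence. assert (ratR b <> z2) by congruence.
  destruct (nonzero_between n f z1 z2 Hmin) as (d & Hd & Fd); try lra.
  (* An error below [|f d|] keeps [f] from vanishing at the rational point [x]. *)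
  destruct (rational_approx f z1 d z2 (Rabs (f d)) cont) as (x & Hx & Fx); try lra.
  { now apply Rabs_pos_lt. }
  assert (f (ratR x) <> 0) as Fx0.
  { intros E. rewrite E, Rminus_0_l, Rabs_Ropp in Fx. lra. }
  apply Rabs_pos_lt in Fa, Fb, Fx0.
  set (mu := Rmin (Rmin (Rabs (f (ratR a))) (Rabs (f (ratR b)))) (Rabs (f (ratR x)))).
  assert (0 < mu) as Hmu by (repeat apply Rmin_glb_lt; assumption).
  assert (mu <= Rabs (f (ratR a)) /\ mu <= Rabs (f (ratR b)) /\ mu <= Rabs (f (ratR x)))
    as (Ma & Mb & Mx).
  { unfold mu. repeat split; [..|apply Rmin_r];
      (eapply Rle_trans; [apply Rmin_l|apply Rmin_l || apply Rmin_r]). }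
  destruct (rational_approx f (ratR a) z1 (ratR x) (mu / 2) cont) as (y & Hy & Fy); try lra.
  destruct (rational_approx f (ratR x) z2 (ratR b) (mu / 2) cont) as (z & Hz & Fz); try lra.
  rewrite Z1, Rminus_0_r in Fy. rewrite Z2, Rminus_0_r in Fz.
  (* [|f|] is below [mu / 2] at [y] and [z], so the gap [4 * / 2 ^ j] of [below_complete] has to fit
     into the other half of [mu]. *)
  destruct (pow2inv_small (mu / 8)) as (j & Hj); [lra|].
  exists j, x, y, z. unfold split_ok.
  rewrite !Bool.andb_true_iff, !ltQ_spec.
  repeat split; try lra; apply below_complete; lra.
Qed.

(** Cells are tested at their left grid point, hence the asymmetry. A cell reaching left of [x]
    starts where [|f|] is bounded below; a cell reaching right of [y] may start before [y], but on a
    fine grid it starts after the buffer point [y']. *)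
Lemma cell_ok_complete j a b x y N i y' mu :
  0 <= ratR a -> ratR b <= 1 -> (i < N)%nat ->
  ratR a <= ratR x -> ratR x <= y' -> y' < ratR y -> ratR y <= ratR b ->
  (forall u, ratR a <= u <= ratR x -> mu <= Rabs (f u)) ->
  (forall u, y' <= u <= ratR b -> mu <= Rabs (f u)) ->
  2 * / 2 ^ j + INR (p j * p j * p j) / INR N < mu -> / INR N < ratR y - y' ->
  cell_ok (p j) j a b x y N i = true.
Proof.
  intros Ha Hb Hi Hax Hxy' Hy'y Hyb M1 M2 Hj HN. unfold cell_ok.
  assert (0 < INR N) as Np by (apply lt_0_INR; lia).
  pose proof (Rinv_0_lt_compat _ Np) as Ni.
  destruct (grid_in_interval a b N i) as [G1 G2]; [lia|lia|lra|].
  assert (mu <= Rabs (f (ratR (grid a b N i))) ->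
    away (p j) j (grid a b N i) (mulQ (mkQ (p j * p j * p j) 0 (pred N)) (subQ b a)) = true) as A.
  { intros M. apply away_complete; [lra|].
    rewrite ratR_mulQ, ratR_mkQ, ratR_subQ. replace (S (pred N)) with N by lia.
    simpl (INR 0). rewrite Rminus_0_r.
    assert (0 <= INR (p j * p j * p j) / INR N) by (apply Rle_mult_inv_pos; [apply pos_INR|lra]).
    nra. }
  destruct (Rlt_le_dec (ratR (grid a b N i)) (ratR x)) as [L|L].
  { rewrite A; [reflexivity|]. apply M1. lra. }
  destruct (Rlt_le_dec (ratR y) (ratR (grid a b N (S i)))) as [L'|L'].
  - rewrite A; [reflexivity|]. apply M2. split; [|lra].
    rewrite ratR_grid in L' |- * by lia. rewrite S_INR in L'.
    replace ((INR i + 1) / INR N) with (INR i / INR N + / INR N) in L' by (field; lra).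
    nra.
  - apply ltQ_false in L, L'. rewrite L, L'. apply Bool.orb_true_r.
Qed.

Lemma shrink_exists t a b z :
  0 <= ratR a -> ratR b <= 1 -> f (ratR a) <> 0 -> f (ratR b) <> 0 ->
  ratR a < z < ratR b -> (forall u, ratR a <= u <= ratR b -> f u = 0 -> u = z) ->
  exists j x y N, (0 < N)%nat /\ shrink_ok (p j) j t a b x y N = true.
Proof.
  intros Ha Hb Fa Fb Hz Uniq.
  assert (0 < / 2 ^ t) as Ht by (apply Rinv_0_lt_compat, pow_lt; lra).
  destruct (ratR_dense (Rmax (ratR a) (z - / 2 ^ t / 2)) z) as (x & Hx).
  { apply Rmax_lub_lt; lra. }
  destruct (ratR_dense z (Rmin (ratR b) (z + / 2 ^ t / 2))) as (y & Hy).
  { apply Rmin_glb_lt; lra. }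
  pose proof (Rmax_l (ratR a) (z - / 2 ^ t / 2)). pose proof (Rmax_r (ratR a) (z - / 2 ^ t / 2)).
  pose proof (Rmin_l (ratR b) (z + / 2 ^ t / 2)). pose proof (Rmin_r (ratR b) (z + / 2 ^ t / 2)).
  set (y' := (z + ratR y) / 2).
  assert (z < y' < ratR y) as Hy' by (unfold y'; lra).
  destruct (nonzero_bounded_away f (ratR a) (ratR x) cont) as (m1 & P1 & M1); try lra.
  { intros u Hu E. apply Uniq in E; lra. }
  destruct (nonzero_bounded_away f y' (ratR b) cont) as (m2 & P2 & M2); try lra.
  { intros u Hu E. apply Uniq in E; lra. }
  set (mu := Rmin m1 m2).
  assert (0 < mu) as Hmu by now apply Rmin_glb_lt.
  assert (forall u, ratR a <= u <= ratR x -> mu <= Rabs (f u)) as M1'.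
  { intros u Hu. eapply Rle_trans; [apply Rmin_l|]. now apply M1. }
  assert (forall u, y' <= u <= ratR b -> mu <= Rabs (f u)) as M2'.
  { intros u Hu. eapply Rle_trans; [apply Rmin_r|]. now apply M2. }
  (* The precision [j] comes first: it fixes the polynomial and with it the Lipschitz constant, to
     which the grid size [N] is then adapted. *)
  destruct (pow2inv_small (mu / 4)) as (j & Hj); [lra|].
  destruct (inv_INR_small (INR (p j * p j * p j)) (Rmin (mu / 4) (ratR y - y')))
    as (N & HN & HN1 & HN2); [apply pos_INR|apply Rmin_glb_lt; lra|].
  pose proof (Rmin_l (mu / 4) (ratR y - y')). pose proof (Rmin_r (mu / 4) (ratR y - y')).
  pose proof (M1' (ratR x) ltac:(lra)). pose proof (M2' (ratR y) ltac:(lra)).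
  exists j, x, y, N. split; [exact HN|]. unfold shrink_ok.
  rewrite !Bool.andb_true_iff, !ltQ_false, !ltQ_spec, ratR_subQ, ratR_pow2invQ, all_below_spec.
  repeat split; try lra; try (apply away_complete; [|rewrite ratR_0]; lra).
  intros i Hi. apply (cell_ok_complete j a b x y N i y' mu); try assumption; lra.
Qed.

Definition good (a b : nat) : Prop :=
  0 <= ratR a /\ ratR a < ratR b /\ ratR b <= 1 /\ f (ratR a) <> 0 /\ f (ratR b) <> 0.

Lemma certificate_exists n t s : at_most_n_local_minima n f ->
  good (left_end s) (right_end s) ->
  exists c, certifies (p (cert_j c)) t s c = true.
Proof.
  intros Hmin (Ha & Hab & Hb & Fa & Fb).
  destruct (Classical_Prop.classic (exists z1 z2, ratR (left_end s) <= z1 /\ z1 < z2 /\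
    z2 <= ratR (right_end s) /\ f z1 = 0 /\ f z2 = 0)) as [(z1 & z2 & H1 & H2 & H3 & Z1 & Z2)|One].
  - destruct (split_exists n (left_end s) (right_end s) z1 z2) as (j & x & y & z & H);
      try assumption.
    exists (step_code j x y z 0). unfold certifies, step_code, cert_N, cert_j, cert_x, cert_y, cert_z.
    rewrite ?pi2_npair, ?pi1_npair, ?pi2_npair, ?pi1_npair. exact H.
  - assert (exists z, ratR (left_end s) < z < ratR (right_end s) /\
      forall u, ratR (left_end s) <= u <= ratR (right_end s) -> f u = 0 -> u = z) as (z & Hz & Uniq).
    { destruct (Classical_Prop.classic (exists z, ratR (left_end s) <= z <= ratR (right_end s) /\
        f z = 0)) as [(z & Hz & Z)|None].
      - exists z. assert (ratR (left_end s) <> z) by congruence.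
        assert (ratR (right_end s) <> z) by congruence. split; [lra|].
        intros u Hu U. destruct (Rtotal_order u z) as [L|[E|L]]; [|exact E|]; exfalso; apply One.
        + exists u, z. repeat split; tauto || lra.
        + exists z, u. repeat split; tauto || lra.
      (* Without zeros any inner point can serve as the target of the shrinking. *)
      - exists ((ratR (left_end s) + ratR (right_end s)) / 2). split; [lra|].
        intros u Hu U. exfalso. apply None. now exists u. }
    destruct (shrink_exists t (left_end s) (right_end s) z) as (j & x & y & N & HN & H);
      try assumption.
    exists (step_code j x y 0 N). unfold certifies, step_code, cert_N, cert_j, cert_x, cert_y, cert_z.
    rewrite ?pi2_npair, ?pi1_npair, ?pi2_npair, ?pi1_npair.
    destruct N as [|N]; [lia|]. exact H.
Qed.
End Progress.

(** * Runs *)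

Lemma left_end_state a b i : left_end (state a b i) = a.
Proof. apply pi1_npair. Qed.

Lemma right_end_state a b i : right_end (state a b i) = b.
Proof. unfold right_end, state. now rewrite pi2_npair, pi1_npair. Qed.

Lemma choices_state a b i : choices (state a b i) = i.
Proof. unfold choices, state. now rewrite !pi2_npair. Qed.

Lemma certifies_choices w t a b i i' c :
  certifies w t (state a b i) c = certifies w t (state a b i') c.
Proof. unfold certifies. now rewrite !left_end_state, !right_end_state. Qed.

(** This refers to the whole name rather than to a prefix, so runs can be studied apart from the
    finite search that simulates them. *)
Definition least_certificate (p : Baire) (t s c : nat) : Prop :=
  certifies (p (cert_j c)) t s c = true /\
  forall c', (c' < c)%nat -> certifies (p (cert_j c')) t s c' = false.

Lemma least_certificate_choices p t a b i i' c :
  least_certificate p t (state a b i) c -> least_certificate p t (state a b i') c.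
Proof.
  intros [H M]. split; [now rewrite (certifies_choices _ _ _ _ _ i)|].
  intros c' Hc. rewrite (certifies_choices _ _ _ _ _ i). auto.
Qed.

Lemma least_certificate_unique p t s c c' :
  least_certificate p t s c -> least_certificate p t s c' -> c = c'.
Proof.
  intros [H M] [H' M']. destruct (Nat.lt_trichotomy c c') as [L|[E|L]]; [|exact E|].
  - rewrite M' in H by exact L. discriminate.
  - rewrite M in H' by exact L. discriminate.
Qed.

Lemma least_certificate_exists p t s :
  (exists c, certifies (p (cert_j c)) t s c = true) -> exists c, least_certificate p t s c.
Proof.
  intros (c & Hc).
  destruct (search_spec (fun c => certifies (p (cert_j c)) t s c) (S c)) as (L & H & M).
  set (c0 := search _ _) in *. exists c0. split; [|exact M].
  apply H. destruct (Nat.eq_dec c0 (S c)) as [E|E]; [|lia].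
  rewrite M in Hc by lia. discriminate.
Qed.

Inductive steps (p : Baire) : nat -> nat -> nat -> nat -> Prop :=
| steps_0 t s : steps p t s 0 s
| steps_S t s c T s' :
    least_certificate p t s c -> steps p (S t) (next s c) T s' -> steps p t s (S T) s'.

Lemma steps_app p t s T s' T' s'' :
  steps p t s T s' -> steps p (t + T) s' T' s'' -> steps p t s (T + T') s''.
Proof.
  intros H. revert T' s''. induction H as [t s|t s c T s' Hc H IH]; intros T' s'' H'.
  - rewrite Nat.add_0_r in H'. exact H'.
  - simpl. apply steps_S with c; [exact Hc|]. apply IH.
    now replace (S t + T)%nat with (t + S T)%nat by lia.
Qed.

Lemma steps_split p t s T T' s'' : steps p t s (T + T') s'' ->
  exists s', steps p t s T s' /\ steps p (t + T) s' T' s''.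
Proof.
  revert t s. induction T as [|T IH]; intros t s H.
  - exists s. rewrite Nat.add_0_r. split; [constructor|exact H].
  - inversion H as [|? ? c ? ? Hc H']; subst.
    destruct (IH _ _ H') as (s' & H1 & H2). exists s'. split.
    + now apply steps_S with c.
    + now replace (t + S T)%nat with (S t + T)%nat by lia.
Qed.

Lemma steps_unique p t s T s1 s2 : steps p t s T s1 -> steps p t s T s2 -> s1 = s2.
Proof.
  intros H. induction H as [t s|t s c T s' Hc H IH]; intros H2.
  - now inversion H2.
  - inversion H2 as [|? ? c' ? ? Hc' H']; subst.
    rewrite (least_certificate_unique _ _ _ _ _ Hc' Hc) in H'. auto.
Qed.

(** * Simulating a run on finite prefixes of a name *)

Section Associate.
Context (p : Baire).

Definition input (pos k : nat) : nat := code_list (pos :: prefix p k).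

Lemma prefix_length k : length (prefix p k) = k.
Proof. unfold prefix. now rewrite length_map, length_seq. Qed.

Lemma code_list_length l : (length l <= code_list l)%nat.
Proof.
  induction l as [|a l IH]; simpl; [lia|]. pose proof (npair_ge a (code_list l)). lia.
Qed.

(** Requiring [c < k] makes the entry [cert_j c <= c] available, and the entries of all smaller
    candidates as well. Hence the first certificate found on a prefix is the least one for the whole
    name. *)
Lemma valid_input pos k t s c :
  valid (input pos k) t s c = ((c <? k) && certifies (p (cert_j c)) t s c)%bool.
Proof.
  unfold valid, input. rewrite tail_code_list. simpl skipn.
  destruct (Nat.ltb_spec c k) as [L|L].
  - assert (0 <? code_list (skipn c (prefix p k)) = true)%nat as ->.
    { apply Nat.ltb_lt. eapply Nat.lt_le_trans; [|apply code_list_length].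
      rewrite length_skipn, prefix_length. lia. }
    f_equal. rewrite nth_code_list. simpl nth. f_equal.
    pose proof (pi1_le c : (cert_j c <= c)%nat). unfold prefix.
    rewrite nth_indep with (d' := p 0%nat) by (rewrite length_map, length_seq; lia).
    rewrite map_nth, seq_nth by lia. reflexivity.
  - rewrite skipn_all2 by (rewrite prefix_length; exact L). reflexivity.
Qed.

Lemma find_input pos k t s c : least_certificate p t s c -> (c < k)%nat ->
  find_certificate (input pos k) t s = c /\ valid (input pos k) t s c = true.
Proof.
  intros [H M] Hc.
  assert (valid (input pos k) t s c = true) as V.
  { rewrite valid_input, H. apply Nat.ltb_lt in Hc. now rewrite Hc. }
  split; [|exact V]. apply search_least; [|exact V|].
  - eapply Nat.lt_le_trans; [exact Hc|].
    pose proof (code_list_length (pos :: prefix p k)) as L. simpl length in L.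
    rewrite prefix_length in L. unfold input. lia.
  - intros m Hm. rewrite valid_input, M by exact Hm. apply Bool.andb_false_r.
Qed.

Lemma run_S L i T : run L i (S T) =
  if ((0 <? run L i T)%nat && valid L T (pred (run L i T)) (find_certificate L T (pred (run L i T))))%bool
  then S (next (pred (run L i T)) (find_certificate L T (pred (run L i T)))) else 0%nat.
Proof. reflexivity. Qed.

Lemma run_complete i T s : steps p 0 (init i) T s ->
  exists k0, forall k pos, (k0 <= k)%nat -> run (input pos k) i T = S s.
Proof.
  revert s. induction T as [|T IH]; intros s H.
  - inversion H; subst. exists 0%nat. reflexivity.
  - replace (S T) with (T + 1)%nat in H by lia.
    apply steps_split in H as (s' & H1 & H2).
    inversion H2 as [|? ? c ? ? Hc H3]; subst. inversion H3; subst.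
    destruct (IH s' H1) as (k0 & Hk). exists (Nat.max k0 (S c)). intros k pos L.
    rewrite run_S, Hk by lia. simpl pred.
    destruct (find_input pos k T s' c Hc) as [-> ->]; [lia|]. reflexivity.
Qed.

(** A prefix may be too short but never misleads: each successful step used a certificate that is
    least for the whole name. *)
Lemma run_sound i T s pos k : run (input pos k) i T = S s -> steps p 0 (init i) T s.
Proof.
  revert s. induction T as [|T IH]; intros s H.
  - injection H as <-. constructor.
  - rewrite run_S in H. destruct (run (input pos k) i T) as [|s']; [discriminate|].
    simpl pred in H. simpl ((0 <? S s')%nat && _)%bool in H.
    destruct (search_spec (fun c => valid (input pos k) T s' c) (input pos k)) as (_ & _ & M).
    fold (find_certificate (input pos k) T s') in M. set (c := find_certificate (input pos k) T s') in *.
    destruct (valid (input pos k) T s' c) eqn:V; [|discriminate]. injection H as <-.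
    rewrite valid_input in V. apply andb_prop in V as [V1 V2]. apply Nat.ltb_lt in V1.
    replace (S T) with (T + 1)%nat by lia.
    apply steps_app with s'; [now apply IH|].
    apply steps_S with c; [|constructor]. split; [exact V2|].
    intros c' Hc'. apply M in Hc' as V'. rewrite valid_input in V'.
    assert (c' <? k = true)%nat as E by (apply Nat.ltb_lt; lia). now rewrite E in V'.
Qed.

Lemma associate_input D pos k :
  associate D (input pos k) =
    match run (input pos k) (pi1 pos) (S (pi2 pos + D)) with
    | O => O
    | S s => S (left_end s)
    end.
Proof.
  unfold associate, input at 2 3 5 6. rewrite nth_code_list. simpl nth.
  now destruct (run (input pos k) (pi1 pos) (S (pi2 pos + D))).
Qed.

Lemma associate_output D pos s : steps p 0 (init (pi1 pos)) (S (pi2 pos + D)) s ->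
  assoc_app (associate D) p pos (left_end s).
Proof.
  intros H. destruct (run_complete _ _ _ H) as (k0 & Hk0).
  (* An associate answers at the first prefix with a nonzero value, perhaps long before [k0].
     Soundness and uniqueness of runs show that this answer is the right one. *)
  destruct (search_spec (fun k => negb (associate D (input pos k) =? 0)%nat) (S k0))
    as (L & P & M).
  set (k := search _ _) in *.
  assert (k < S k0)%nat as Hk.
  { destruct (Nat.eq_dec k (S k0)) as [E|E]; [|lia].
    specialize (M k0 ltac:(lia)). rewrite associate_input, Hk0 in M by lia. discriminate. }
  exists k. split.
  - specialize (P Hk). fold (input pos k). rewrite associate_input in P |- *.
    destruct (run (input pos k) (pi1 pos) (S (pi2 pos + D))) as [|s'] eqn:E; [discriminate|].
    apply run_sound in E. now rewrite (steps_unique _ _ _ _ _ _ E H).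
  - intros j Hj. apply M, Bool.negb_false_iff, Nat.eqb_eq in Hj. exact Hj.
Qed.
End Associate.

(** * Branches of the search: split budget, widths and tracked zeros *)

Section Tracking.
Context (p : Baire) (f : R -> R) (n : nat).
Context (name : name_C p f) (cont : cont01 f) (minima : at_most_n_local_minima n f).

(** The successor is described for all digit strings at once, because tracking a zero fixes the
    digits only afterwards. *)
Lemma certificate_cases t a b i c : good f a b ->
  certifies (p (cert_j c)) t (state a b i) c = true ->
  (exists x, good f a x /\ good f x b /\
     dips f 1 (ratR a) (ratR x) /\ dips f 1 (ratR x) (ratR b) /\
     forall i, next (state a b i) c =
       if Nat.even i then state a x (Nat.div2 i) else state x b (Nat.div2 i)) \/
  (exists x y, good f x y /\ ratR a <= ratR x /\ ratR y <= ratR b /\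
     ratR y - ratR x < / 2 ^ t /\
     (forall z, ratR a <= z <= ratR b -> f z = 0 -> ratR x <= z <= ratR y) /\
     forall i, next (state a b i) c = state x y i).
Proof.
  intros (Ha & Hab & Hb & Fa & Fb) H. unfold certifies in H.
  rewrite left_end_state, right_end_state in H. unfold next.
  destruct (Nat.eqb_spec (cert_N c) 0) as [E|E].
  - left. apply (split_ok_sound p f name) in H as ((Y1 & Y2) & (Z1 & Z2) & Ya & Yx & Zx & Zb);
      try assumption.
    assert (f (ratR (cert_x c)) <> 0) as Fx.
    { intros Fx. rewrite Fx, Rabs_R0 in Yx. pose proof (Rabs_pos (f (ratR (cert_y c)))). lra. }
    exists (cert_x c). unfold good. repeat split; try lra; try assumption.
    + apply (dips_S f 0 _ (ratR a) (ratR (cert_y c)) (ratR (cert_x c))); try lra.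
      constructor. lra.
    + apply (dips_S f 0 _ (ratR (cert_x c)) (ratR (cert_z c)) (ratR b)); try lra.
      constructor. lra.
    + intros i'. now rewrite left_end_state, right_end_state, choices_state.
  - right. apply (shrink_ok_sound p f name) in H as (X & XY & Y & W & Fx & Fy & Z);
      try assumption; [|lia].
    exists (cert_x c), (cert_y c). unfold good. repeat split; try lra; try assumption.
    1,2: now apply Z.
    intros i'. now rewrite choices_state.
Qed.

(** [D] is the budget of splits still possible. A split exhibits two dips, so the bound [S D] rules
    it out when [D] is 0. *)
Definition few_dips (D a b : nat) : Prop :=
  forall k, dips f k (ratR a) (ratR b) -> (k <= S D)%nat.

Lemma few_dips_left D a x b : few_dips D a b -> dips f 1 (ratR x) (ratR b) ->
  few_dips (pred D) a x.
Proof.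
  intros H Hx k Hk. pose proof (H _ (dips_app _ _ _ _ _ _ Hk Hx)). lia.
Qed.

Lemma few_dips_right D a x b : few_dips D a b -> dips f 1 (ratR a) (ratR x) ->
  few_dips (pred D) x b.
Proof.
  intros H Hx k Hk. pose proof (H _ (dips_app _ _ _ _ _ _ Hx Hk)). lia.
Qed.

Lemma few_dips_split D a x b : few_dips D a b ->
  dips f 1 (ratR a) (ratR x) -> dips f 1 (ratR x) (ratR b) -> D = S (pred D).
Proof. intros H H1 H2. pose proof (H _ (dips_app _ _ _ _ _ _ H1 H2)). lia. Qed.

Lemma few_dips_narrow D a b x y : few_dips D a b -> ratR a <= ratR x -> ratR y <= ratR b ->
  few_dips D x y.
Proof. intros H Hx Hy k Hk. apply H. now apply dips_widen with (ratR x) (ratR y). Qed.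

Lemma steps_good t s T s' : steps p t s T s' ->
  forall D, good f (left_end s) (right_end s) -> few_dips D (left_end s) (right_end s) ->
  good f (left_end s') (right_end s') /\ few_dips D (left_end s') (right_end s') /\
  ratR (left_end s) <= ratR (left_end s') /\ ratR (right_end s') <= ratR (right_end s).
Proof.
  induction 1 as [t s|t s c T s' [Hc _] H IH]; intros D G F.
  - repeat split; try assumption; try apply G; lra.
  - assert (s = state (left_end s) (right_end s) (choices s)) as Es
      by (unfold state, left_end, right_end, choices; now rewrite !npair_pi).
    set (a := left_end s) in *. set (b := right_end s) in *. rewrite Es in Hc, IH.
    destruct (certificate_cases _ _ _ _ _ G Hc)
      as [(x & G1 & G2 & D1 & D2 & N)|(x & y & G' & X & Y & _ & _ & N)].
    + rewrite N in IH. destruct (Nat.even (choices s));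
        rewrite left_end_state, right_end_state in IH; destruct (IH D) as (I1 & I2 & I3 & I4);
        try assumption.
      * apply (few_dips_narrow D a b); [exact F|lra|apply Rlt_le, G2].
      * repeat split; try assumption; try apply I1. apply Rle_trans with (ratR x); [exact I4|].
        apply Rlt_le, G2.
      * apply (few_dips_narrow D a b); [exact F|apply Rlt_le, G1|lra].
      * repeat split; try assumption; try apply I1. apply Rle_trans with (ratR x); [|exact I3].
        apply Rlt_le, G1.
    + rewrite N, left_end_state, right_end_state in IH.
      destruct (IH D) as (I1 & I2 & I3 & I4); try assumption.
      * now apply (few_dips_narrow D a b).
      * repeat split; try assumption; try apply I1; lra.
Qed.

Lemma steps_exist t s T : good f (left_end s) (right_end s) -> exists s', steps p t s T s'.
Proof.
  intros G. induction T as [|T (s' & IH)]; [exists s; constructor|].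
  assert (few_dips (3 * n + 1) (left_end s) (right_end s)) as F.
  { intros k Hk. destruct G as (Ha & _ & Hb & _).
    pose proof (dips_bound n f k _ _ cont minima Ha Hb Hk). lia. }
  destruct (steps_good _ _ _ _ IH _ G F) as (G' & _).
  destruct (least_certificate_exists p (t + T) s') as (c & Hc).
  { now apply (certificate_exists p f name cont n). }
  exists (next s' c). replace (S T) with (T + 1)%nat by lia.
  apply steps_app with s'; [exact IH|]. apply steps_S with c; [exact Hc|constructor].
Qed.

(* At most [D] of the first [S D] steps split the interval; the others shrink it. *)
Lemma steps_width D t a b i s' : good f a b -> few_dips D a b ->
  steps p t (state a b i) (S D) s' -> ratR (right_end s') - ratR (left_end s') <= / 2 ^ t.
Proof.
  assert (0 < 2) as H2 by lra.
  revert t a b i. induction D as [|D IH]; intros t a b i G F H;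
    inversion H as [|? ? c ? ? Hc H']; subst;
    destruct (certificate_cases _ _ _ _ _ G (proj1 Hc))
      as [(x & G1 & G2 & D1 & D2 & N)|(x & y & G' & X & Y & W & _ & N)].
  - pose proof (few_dips_split _ _ _ _ F D1 D2). discriminate.
  - inversion H'; subst. rewrite N, left_end_state, right_end_state. lra.
  - assert (ratR (right_end s') - ratR (left_end s') <= / 2 ^ S t) as I.
    { rewrite N in H'. destruct (Nat.even i).
      - apply (IH _ _ _ _ G1 (few_dips_left _ _ _ _ F D2) H').
      - apply (IH _ _ _ _ G2 (few_dips_right _ _ _ _ F D1) H'). }
    eapply Rle_trans; [exact I|]. apply Rinv_le_contravar; [now apply pow_lt|].
    apply Rle_pow; lra || lia.
  - assert (few_dips (S D) x y) as F' by now apply (few_dips_narrow _ a b).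
    rewrite N in H'. apply steps_good with (D := S D) in H';
      rewrite ?left_end_state, ?right_end_state in *; [lra|assumption..].
Qed.

(** [next] consumes the lowest binary digit first, so the digit chosen at a split is placed below
    the index that the induction gives for the remaining steps. *)
Lemma zero_tracked D t a b z T : good f a b -> few_dips D a b ->
  ratR a <= z <= ratR b -> f z = 0 ->
  exists i, (i < 2 ^ D)%nat /\ exists s', steps p t (state a b i) T s' /\
    ratR (left_end s') <= z <= ratR (right_end s').
Proof.
  revert D t a b. induction T as [|T IH]; intros D t a b G F Hz Z.
  - exists 0%nat. split; [apply pow2_pos|]. exists (state a b 0). split; [constructor|].
    now rewrite left_end_state, right_end_state.
  - destruct (least_certificate_exists p t (state a b 0)) as (c & Hc).
    { apply (certificate_exists p f name cont n); [exact minima|].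
      now rewrite left_end_state, right_end_state. }
    destruct (certificate_cases _ _ _ _ _ G (proj1 Hc))
      as [(x & G1 & G2 & D1 & D2 & N)|(x & y & G' & X & Y & _ & Zxy & N)].
    + rewrite (few_dips_split _ _ _ _ F D1 D2). simpl Nat.pow.
      destruct (Rle_lt_dec z (ratR x)) as [L|L].
      * destruct (IH (pred D) (S t) a x G1 (few_dips_left _ _ _ _ F D2)) as (i & Hi & s' & H & H');
          [lra|exact Z|].
        exists (2 * i)%nat. split; [lia|]. exists s'. split; [|exact H'].
        apply steps_S with c; [now apply least_certificate_choices with 0%nat|].
        now rewrite N, Nat.even_even, Nat.div2_double.
      * destruct (IH (pred D) (S t) x b G2 (few_dips_right _ _ _ _ F D1)) as (i & Hi & s' & H & H');
          [lra|exact Z|].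
        exists (2 * i + 1)%nat. split; [lia|]. exists s'. split; [|exact H'].
        apply steps_S with c; [now apply least_certificate_choices with 0%nat|].
        rewrite N, Nat.even_odd. replace (2 * i + 1)%nat with (S (2 * i)) by lia.
        now rewrite Nat.div2_succ_double.
    + destruct (IH D (S t) x y G') as (i & Hi & s' & H & H');
        [now apply (few_dips_narrow D a b)|now apply Zxy|exact Z|].
      exists i. split; [exact Hi|]. exists s'. split; [|exact H'].
      apply steps_S with c; [now apply least_certificate_choices with 0%nat|].
      now rewrite N.
Qed.

(** The index supplied by [zero_tracked] depends on the number of steps. An index that fails once
    fails ever after and can be discarded, so one index must survive. *)
Lemma pigeonhole (P : nat -> nat -> Prop) N :
  (forall T, exists i, (i < N)%nat /\ P i T) -> (forall i T, P i (S T) -> P i T) ->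
  exists i, (i < N)%nat /\ forall T, P i T.
Proof.
  intros H Mono.
  assert (forall i T T', (T <= T')%nat -> P i T' -> P i T) as Mono'.
  { intros i T T'. induction 1; auto. }
  clear Mono. induction N as [|N IH].
  - destruct (H 0%nat) as (i & Hi & _). lia.
  - destruct (Classical_Prop.classic (forall T, P N T)) as [A|A].
    + exists N. split; [lia|exact A].
    + apply Classical_Pred_Type.not_all_ex_not in A as (T0 & HT0).
      destruct IH as (i & Hi & A).
      * intros T. destruct (H (Nat.max T T0)) as (i & Hi & HP).
        assert (i <> N) by (intros ->; apply HT0, (Mono' _ _ (Nat.max T T0)); [lia|exact HP]).
        exists i. split; [lia|]. apply (Mono' _ _ (Nat.max T T0)); [lia|exact HP].
      * exists i. split; [lia|exact A].
Qed.

(** * Limits of the branches starting from the unit interval *)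

Context (f0 : f 0 <> 0) (f1 : f 1 <> 0).
Let D := (3 * n + 1)%nat.

Lemma init_good i : good f (left_end (init i)) (right_end (init i)) /\
  few_dips D (left_end (init i)) (right_end (init i)).
Proof.
  unfold init, good, few_dips.
  rewrite left_end_state, right_end_state, ratR_0, ratR_one. split; [repeat split; auto; lra|].
  intros k Hk. pose proof (dips_bound n f k 0 1 cont minima ltac:(lra) ltac:(lra) Hk). lia.
Qed.

Lemma init_width i m s : steps p 0 (init i) (S (m + D)) s ->
  ratR (right_end s) - ratR (left_end s) <= / 2 ^ m.
Proof.
  intros H. replace (S (m + D)) with (m + S D)%nat in H by lia.
  apply steps_split in H as (s0 & H0 & H). destruct (init_good i) as (G & F).
  destruct (steps_good _ _ _ _ H0 D G F) as (G0 & F0 & _).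
  apply (steps_width D m (left_end s0) (right_end s0) (choices s0)); try assumption.
  unfold state, left_end, right_end, choices. rewrite !npair_pi. exact H.
Qed.

Lemma steps_nested i T T' s s' : steps p 0 (init i) T s -> steps p 0 (init i) T' s' ->
  (T <= T')%nat -> ratR (left_end s) <= ratR (left_end s') /\
  ratR (right_end s') <= ratR (right_end s).
Proof.
  intros H H' L. replace T' with (T + (T' - T))%nat in H' by lia.
  apply steps_split in H' as (s0 & H0 & H'). rewrite (steps_unique _ _ _ _ _ _ H0 H) in H'.
  destruct (init_good i) as (G & F). destruct (steps_good _ _ _ _ H D G F) as (G0 & F0 & _).
  apply (steps_good _ _ _ _ H' D G0 F0).
Qed.

(** The supremum of the left ends. Every index gets a limit, whether or not its branch holds a
    zero. *)
Lemma limit_exists i : exists y, 0 <= y <= 1 /\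
  forall T s, steps p 0 (init i) T s -> ratR (left_end s) <= y <= ratR (right_end s).
Proof.
  assert (forall T T' s s', steps p 0 (init i) T s -> steps p 0 (init i) T' s' ->
    ratR (left_end s) <= ratR (right_end s')) as Cross.
  { intros T T' s s' H H'. destruct (init_good i) as (G & F).
    destruct (steps_good _ _ _ _ H D G F) as ((_ & G1 & _) & _).
    destruct (steps_good _ _ _ _ H' D G F) as ((_ & G2 & _) & _).
    destruct (Nat.le_ge_cases T T') as [L|L].
    - destruct (steps_nested i T T' s s' H H' L). lra.
    - destruct (steps_nested i T' T s' s H' H L). lra. }
  destruct (completeness (fun x => exists T s, steps p 0 (init i) T s /\ x = ratR (left_end s)))
    as (y & Ub & Lub).
  - exists (ratR (right_end (init i))). intros x (T & s & H & ->).
    apply (Cross T 0%nat); [exact H|constructor].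
  - exists (ratR (left_end (init i))), 0%nat, (init i). split; [constructor|reflexivity].
  - assert (forall T s, steps p 0 (init i) T s -> ratR (left_end s) <= y <= ratR (right_end s)) as Y.
    { intros T s H. split.
      - apply Ub. now exists T, s.
      - apply Lub. intros x (T' & s' & H' & ->). now apply (Cross T' T). }
    exists y. split; [|exact Y]. pose proof (Y 0%nat _ (steps_0 p 0 (init i))) as Y0.
    unfold init in Y0. rewrite left_end_state, right_end_state, ratR_0, ratR_one in Y0. exact Y0.
Qed.

Lemma Zero_realized : exists q : Baire,
  (forall pos, assoc_app (associate D) p pos (q pos)) /\
  exists y, name_cube (2 ^ D) q y /\ Zero_rel (2 ^ D) f y.
Proof.
  assert (forall i T, exists s, steps p 0 (init i) T s) as Ex
    by (intros; apply steps_exist, init_good).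
  destruct (functional_choice _ (fun pos => Ex (pi1 pos) (S (pi2 pos + D)))) as (st & Hst).
  destruct (functional_choice _ limit_exists) as (y & Hy).
  exists (fun pos => left_end (st pos)). split.
  { intros pos. apply associate_output, Hst. }
  exists y. split.
  - intros i _. split; [apply Hy|]. intros m.
    specialize (Hst (npair i m)). rewrite pi1_npair, pi2_npair in Hst.
    pose proof (init_width _ _ _ Hst) as W. apply (proj2 (Hy i)) in Hst.
    rewrite Rabs_left1; lra.
  - intros z Hz Z.
    destruct (pigeonhole (fun i T => forall s, steps p 0 (init i) T s ->
      ratR (left_end s) <= z <= ratR (right_end s)) (2 ^ D)) as (i & Hi & Hiz).
    + intros T. destruct (init_good 0) as (G & F).
      unfold init in G, F. rewrite left_end_state, right_end_state in G, F.
      destruct (zero_tracked D 0 0 (mkQ 1 0 0) z T G F) as (i & Hi & s' & H & H').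
      * rewrite ratR_0, ratR_one. exact Hz.
      * exact Z.
      * exists i. split; [exact Hi|]. intros s Hs.
        now rewrite (steps_unique _ _ _ _ _ _ Hs H).
    + intros i T A s Hs. destruct (Ex i (S T)) as (s' & Hs').
      destruct (steps_nested i T (S T) s s' Hs Hs') as [L1 L2]; [lia|].
      specialize (A s' Hs'). lra.
    + exists i. split; [exact Hi|]. apply Classical_Prop.NNPP. intros Hne.
      (* Otherwise [y i] and [z] would lie in a common interval narrower than their distance. *)
      destruct (pow2inv_small (Rabs (y i - z))) as (m & Hm).
      { apply Rabs_pos_lt. lra. }
      destruct (Ex i (S (m + D))) as (s & Hs).
      pose proof (init_width _ _ _ Hs) as W. pose proof (proj2 (Hy i) _ _ Hs) as Y.
      specialize (Hiz _ s Hs). clear - Hm W Y Hiz. split_Rabs; lra.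
Qed.
End Tracking.

Theorem theorem47 :
  exists kappa : nat -> nat, computable_fun kappa /\
    forall n : nat,
      mv_computable name_C (name_cube (kappa n)) (Zero_dom n) (Zero_rel (kappa n)).
Proof.
  exists (fun n => 2 ^ (3 * n + 1))%nat. split.
  - apply computed_fun_intro. computed_tac.
  - intros n. exists (associate (3 * n + 1)). split; [apply associate_computable|].
    intros f (C & M & F0 & F1) p name. now apply Zero_realized.
Qed.
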